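(* Let $\phi:\mathbb{R}^n\to\mathbb{R}$ be convex and differentiable with $\rho^{-1}$-Lipschitz continuous gradient for some $\rho>0$, and let $\psi:\mathbb{R}^n\to\mathbb{R}$ be (possibly nonconvex and) Fréchet differentiable with $L$-Lipschitz continuous gradient for some $L>0$. Let $x_0,v_0\in\mathbb{R}^n$ and $\lambda>0$ be such that $v_0=\nabla\phi(x_0)$. Let $(x,v):[0,+\infty)\to\mathbb{R}^n\times\mathbb{R}^n$ be the unique strong global solution of the dynamical system $$\begin{cases} v(t)=\nabla\phi(x(t))\\ \lambda\dot x(t)+\dot v(t)+\nabla\phi(x(t))+\nabla\psi(x(t))=0\\ x(0)=x_0,\ v(0)=v_0=\nabla\phi(x_0).\end{cases}$$ Suppose that $\phi+\psi$ is a KL function which is bounded from below and that $x$ is bounded. Then the following statements are true: (i) $\dot x,\ \dot v,\ \nabla\phi(x)+\nabla\psi(x)\in L^2([0,+\infty);\mathbb{R}^n)$, $\langle\dot x(\cdot),\dot v(\cdot)\rangle\in L^1([0,+\infty);\mathbb{R})$ and $$\lim_{t\to+\infty}\dot x(t)=\lim_{t\to+\infty}\dot v(t)=\lim_{t\to+\infty}\big(\nabla\phi(x(t))+\nabla\psi(x(t))\big)=0;$$ (ii) there exists $\overline{x}\in\mathbb{R}^n$ with $\nabla(\phi+\psi)(\overline{x})=0$ (that is, a critical point of $\phi+\psi$) such that $\lim_{t\to+\infty}x(t)=\overline{x}$.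
   Context: $\mathbb{R}^n$ carries the Euclidean scalar product $\langle\cdot,\cdot\rangle$ and norm $\|\cdot\|$. A function $x:[0,+\infty)\to\mathbb{R}^n$ is locally absolutely continuous if it is absolutely continuous on every interval $[0,T]$, $T>0$; it is then differentiable almost everywhere. Limits of $\dot x(t),\dot v(t)$ as $t\to+\infty$ are taken over those $t$ at which the derivatives exist. A pair $(x,v)$ is a strong global solution of the system if: $x,v:[0,+\infty)\to\mathbb{R}^n$ are locally absolutely continuous; $v(t)=\nabla\phi(x(t))$ for every $t\ge 0$; $\lambda\dot x(t)+\dot v(t)+v(t)+\nabla\psi(x(t))=0$ for almost every $t\ge 0$; and $x(0)=x_0$, $v(0)=v_0$. (Existence and uniqueness of a strong global solution are known under these assumptions.) For $\eta\in(0,+\infty]$, $\Theta_\eta$ denotes the class of concave and continuous functions $\varphi:[0,\eta)\to[0,+\infty)$ such that $\varphi(0)=0$, $\varphi$ is continuously differentiable on $(0,\eta)$, continuous at $0$, and $\varphi'(s)>0$ for all $s\in(0,\eta)$. For a proper lower semicontinuous $f:\mathbb{R}^n\to\mathbb{R}\cup\{+\infty\}$ with limiting (Mordukhovich) subdifferential $\partial_L f$ (equal to $\{\nabla f(x)\}$ at every $x$ if $f$ is continuously differentiable), $f$ satisfies the Kurdyka–Łojasiewicz (KL) property at $\overline{x}\in\{x:\partial_L f(x)\ne\emptyset\}$ if there exist $\eta\in(0,+\infty]$, a neighborhood $U$ of $\overline{x}$ and $\varphi\in\Theta_\eta$ such that for all $x\in U$ with $f(\overline{x})<f(x)<f(\overline{x})+\eta$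 one has $$\varphi'(f(x)-f(\overline{x}))\,\mathrm{dist}(0,\partial_L f(x))\ge 1,$$ where $\mathrm{dist}(x,A)=\inf_{y\in A}\|x-y\|$. $f$ is a KL function if it satisfies the KL property at each point where $\partial_L f$ is nonempty. For $f=\phi+\psi$ as in the claim (continuously differentiable), $\mathrm{dist}(0,\partial_L f(x))=\|\nabla f(x)\|$ and this means the KL property holds at every point of $\mathbb{R}^n$. *)

(* Defs.v *)
From HB Require Import structures.
From mathcomp Require Export all_boot all_order all_algebra.
From mathcomp Require Export all_classical all_reals all_analysis.
Export Order.TTheory GRing.Theory Num.Theory numFieldNormedType.Exports.

Set Implicit Arguments.
Unset Strict Implicit.
Unset Printing Implicit Defensive.

Local Open Scope classical_set_scope.
Local Open Scope ring_scope.

(* The canonical norm of 'rV[R]_n is the sup norm, hence the Euclidean one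
   below; both induce the same topology and the same derivatives, so limits,
   neighbourhoods and derivatives are those of the library. *)
Definition dotv (R : realType) (n : nat) (a b : 'rV[R]_n) : R :=
  \sum_(i < n) a 0 i * b 0 i.

Definition enorm (R : realType) (n : nat) (a : 'rV[R]_n) : R :=
  Num.sqrt (dotv a a).

Definition grad (R : realType) (n : nat) (f : 'rV[R]_n -> R)
    (a : 'rV[R]_n) : 'rV[R]_n :=
  \row_(i < n) 'D_(delta_mx 0 i) (f : 'rV[R]_n -> R^o) a.

Definition elipschitz (R : realType) (n : nat) (k : R)
    (F : 'rV[R]_n -> 'rV[R]_n) : Prop :=
  forall a b : 'rV[R]_n, enorm (F a - F b) <= k * enorm (a - b).

Definition abs_continuous (R : realType) (n : nat) (a b : R)
    (f : R -> 'rV[R]_n) : Prop :=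
  forall e : R, 0 < e -> exists2 d : R, 0 < d &
    forall (m : nat) (s : 'I_m -> R * R),
      (forall i, [/\ a <= (s i).1, (s i).1 <= (s i).2 & (s i).2 <= b]) ->
      trivIset [set: 'I_m] (fun i => `](s i).1, (s i).2[%classic) ->
      \sum_(i < m) ((s i).2 - (s i).1) < d ->
      \sum_(i < m) enorm (f (s i).2 - f (s i).1) < e.

(* Functions on [0, +oo) are total functions on R whose values on the negative
   reals are irrelevant. *)
Definition loc_abs_continuous (R : realType) (n : nat)
    (f : R -> 'rV[R]_n) : Prop :=
  forall T : R, 0 < T -> abs_continuous 0 T f.

Definition strong_global_solution (R : realType) (n : nat)
    (phi psi : 'rV[R]_n -> R) (lambda : R) (x0 v0 : 'rV[R]_n)
    (x v : R -> 'rV[R]_n) : Prop :=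
  [/\ loc_abs_continuous x /\ loc_abs_continuous v,
      forall t : R, 0 <= t -> v t = grad phi (x t),
      {ae (@lebesgue_measure R), forall t, 0 <= t ->
        [/\ derivable x t 1, derivable v t 1 &
            lambda *: derive1 x t + derive1 v t + v t + grad psi (x t) = 0]} &
      x 0 = x0 /\ v 0 = v0].

(* f a is finite and liminf (f b - f a - <p, b - a>) / |b - a| >= 0 as b tends
   to a, b <> a. *)
Definition frechet_subdiff (R : realType) (n : nat) (f : 'rV[R]_n -> \bar R)
    (a : 'rV[R]_n) : set 'rV[R]_n :=
  [set p | f a \is a fin_num /\
    forall e : R, 0 < e -> \forall b \near a,
      (f a + (dotv p (b - a) - e * enorm (b - a))%:E <= f b)%E].

Definition limiting_subdiff (R : realType) (n : nat) (f : 'rV[R]_n -> \bar R)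
    (a : 'rV[R]_n) : set 'rV[R]_n :=
  [set p | f a \is a fin_num /\
    exists (u q : nat -> 'rV[R]_n),
      [/\ u @ \oo --> a, f (u k) @[k --> \oo] --> f a,
          forall k, frechet_subdiff f (u k) (q k) & q @ \oo --> p]].

(* Extended-valued, so that the distance to the empty set is +oo. *)
Definition edist_set (R : realType) (n : nat) (a : 'rV[R]_n)
    (A : set 'rV[R]_n) : \bar R :=
  ereal_inf [set (enorm (a - b))%:E | b in A].

Definition desingularizing (R : realType) (eta : \bar R) (g : R -> R) : Prop :=
  let D := [set s : R | 0 <= s /\ (s%:E < eta)%E] in
  [/\ convex_function (E := R^o) D (fun s => - g s),
      {within D, continuous g},
      g 0 = 0,
      forall s : R, D s -> 0 <= g s &
      forall s : R, 0 < s -> (s%:E < eta)%E ->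
        [/\ derivable (g : R -> R^o) s 1,
            {for s, continuous (derive1 (g : R -> R^o))} &
            0 < derive1 (g : R -> R^o) s]].

Definition KL_property (R : realType) (n : nat) (f : 'rV[R]_n -> \bar R)
    (a : 'rV[R]_n) : Prop :=
  exists (eta : \bar R) (U : set 'rV[R]_n) (g : R -> R),
    [/\ (0 < eta)%E, nbhs a U, desingularizing eta g &
        forall b, U b -> (f a < f b)%E -> (f b < f a + eta)%E ->
          (1 <= (derive1 (g : R -> R^o) (fine (f b - f a)))%:E *
                edist_set 0 (limiting_subdiff f b))%E].

Definition KL_function (R : realType) (n : nat) (f : 'rV[R]_n -> \bar R) :
    Prop :=
  forall a : 'rV[R]_n, limiting_subdiff f a !=set0 -> KL_property f a.

(* Measurability in the library is Borel measurability, and derivatives are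
   only defined almost everywhere; hence Lebesgue spaces are described through
   Borel representatives up to a null set. *)
Definition in_L1_pos (R : realType) (f : R -> R) : Prop :=
  exists2 g : R -> R,
    ae_eq (@lebesgue_measure R) `[0, +oo[%classic f g &
    (@lebesgue_measure R).-integrable `[0, +oo[%classic (EFin \o g).

Definition in_L2_pos (R : realType) (n : nat) (f : R -> 'rV[R]_n) : Prop :=
  exists g : R -> 'rV[R]_n,
    [/\ ae_eq (@lebesgue_measure R) `[0, +oo[%classic f g,
        forall i, measurable_fun (`[0, +oo[%classic : set R) (fun t : R => g t 0 i) &
        (\int[@lebesgue_measure R]_(t in `[0%R, +oo[%classic) (enorm (g t) ^+ 2)%:E
           < +oo)%E].

(* Main.v *)
Require Import Defs.
From mathcomp Require Import measurable_realfun ring lra.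

Set Implicit Arguments.
Unset Strict Implicit.
Unset Printing Implicit Defensive.

Local Open Scope classical_set_scope.
Local Open Scope ring_scope.

(** Put [F = grad phi + grad psi], [Phi = phi + psi] and
[z t = lambda *: x t + v t = (lambda Id + grad phi) (x t)], so that the system
reads [z' = - F (x t)] almost everywhere.  Since [grad phi] is monotone and
Lipschitz, [lambda Id + grad phi] is strongly monotone and Lipschitz: increments
of [x] and of [z] are comparable up to constants,
[lambda |x s - x t| <= |z s - z t| <= (lambda + 1 / rho) |x s - x t|].

The exceptional null set of times is removed from the dynamics by the mean value
inequality for absolutely continuous curves ([abs_continuous_mean_value]).
Applied to [z s + s *: w] on short intervals, with [w] the value of [F (x t)] at
the left end, it shows that the equation [z' = - F (x t)] holds for the right
derivative at every [t >= 0], because [F (x t)] is continuous in [t].  From then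
on the estimates along the trajectory are about right difference quotients at
every time, and are integrated by the fact that a continuous function with
nonpositive upper right Dini derivative is nonincreasing
([right_dini_nonincreasing]).

Energy.  Over a short step [d = s - t], with [y = x s - x t] and [w = z s - z t],
[d <F (x t), y>] is [- <w, y>] up to [o(d ^ 2)], and
[<w, y> >= lambda |y| ^ 2 >= c |w| ^ 2] with [c = lambda / (lambda + 1 / rho) ^ 2].
Hence [Phi (x t)] decreases at rate at least [c |F (x t)| ^ 2] ([energy_dini]).
As [Phi] is bounded below, [|F (x t)| ^ 2] is integrable on the half line, and as
[F (x t)] is Lipschitz in [t], it tends to [0].  Wherever [x] or [v] is
differentiable, the norm of its derivative is at most a constant times
[|F (x t)|]; this gives all of (i).

Convergence.  Let [l] be the limit of [Phi (x t)] and [xbar] a cluster point of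
the bounded curve [x]; then [Phi xbar = l] and [F xbar = 0].  If [g] is the
desingularizing function of the KL inequality at [xbar], then
[c lambda |x t - x t1| + g (Phi (x t) - l)] has nonpositive right Dini derivative
as long as [x] stays where the inequality holds ([lyapunov_dini]): concavity
of [g] turns the decrease of the energy into a decrease of [g (Phi (x t) - l)] at
rate at least [c g' |F| ^ 2 >= c |F|], which pays for the growth of the distance.
So a trajectory that comes close enough to [xbar] with energy close enough to [l]
can never leave a prescribed ball around [xbar] ([trajectory_trapped]); since it
comes arbitrarily close, it converges. *)

(** * Euclidean norm *)

Section Euclid.
Context {R : realType} {n : nat}.
Implicit Types (a b c : 'rV[R]_n) (k : R).

Lemma dotvC a b : dotv a b = dotv b a.
Proof. by apply: eq_bigr => i _; rewrite mulrC. Qed.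

Lemma dotvDl a b c : dotv (a + b) c = dotv a c + dotv b c.
Proof. by rewrite -big_split; apply: eq_bigr => i _; rewrite mxE mulrDl. Qed.

Lemma dotvDr a b c : dotv c (a + b) = dotv c a + dotv c b.
Proof. by rewrite dotvC dotvDl !(dotvC c). Qed.

Lemma dotvZl k a b : dotv (k *: a) b = k * dotv a b.
Proof. by rewrite mulr_sumr; apply: eq_bigr => i _; rewrite mxE mulrA. Qed.

Lemma dotvZr k a b : dotv b (k *: a) = k * dotv b a.
Proof. by rewrite dotvC dotvZl dotvC. Qed.

Lemma dotvNl a b : dotv (- a) b = - dotv a b.
Proof. by rewrite -scaleN1r dotvZl mulN1r. Qed.

Lemma dotvNr a b : dotv b (- a) = - dotv b a.
Proof. by rewrite dotvC dotvNl dotvC. Qed.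

Lemma dotvv_ge0 a : 0 <= dotv a a.
Proof. by apply: sumr_ge0 => i _; rewrite -expr2 sqr_ge0. Qed.

Lemma enorm_ge0 a : 0 <= enorm a.
Proof. exact: sqrtr_ge0. Qed.

Lemma sqr_enorm a : enorm a ^+ 2 = dotv a a.
Proof. by rewrite sqr_sqrtr// dotvv_ge0. Qed.

Lemma coord_le_enorm a (i : 'I_n) : `|a 0 i| <= enorm a.
Proof.
rewrite -sqrtr_sqr ler_wsqrtr// /dotv (bigD1 i)//= -expr2 lerDl.
by apply: sumr_ge0 => j _; rewrite -expr2 sqr_ge0.
Qed.

Lemma enorm_le0_eq0 a : enorm a <= 0 -> a = 0.
Proof.
move=> a0; apply/rowP => i; rewrite !mxE; apply/eqP.
by rewrite -normr_le0 (le_trans (coord_le_enorm _ _)).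
Qed.

Lemma enormZ k a : enorm (k *: a) = `|k| * enorm a.
Proof.
by rewrite /enorm dotvZl dotvZr mulrA -expr2 sqrtrM ?sqr_ge0// sqrtr_sqr.
Qed.

Lemma enormN a : enorm (- a) = enorm a.
Proof. by rewrite -scaleN1r enormZ normrN1 mul1r. Qed.

Lemma enorm0 : enorm (0 : 'rV[R]_n) = 0.
Proof. by rewrite -(scale0r (0 : 'rV[R]_n)) enormZ normr0 mul0r. Qed.

Lemma enormBC a b : enorm (a - b) = enorm (b - a).
Proof. by rewrite -enormN opprB. Qed.

(** Expand the square of [|b| a - |a| b]. *)
Lemma dotv_le a b : dotv a b <= enorm a * enorm b.
Proof.
have [/enorm_le0_eq0 ->|a0] := leP (enorm a) 0.
  by rewrite -(scale0r (0 : 'rV[R]_n)) dotvZl enormZ normr0 !mul0r.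
have [/enorm_le0_eq0 ->|b0] := leP (enorm b) 0.
  by rewrite -(scale0r (0 : 'rV[R]_n)) dotvZr enormZ normr0 !mul0r mulr0.
have := dotvv_ge0 (enorm b *: a - enorm a *: b).
rewrite !(dotvDl, dotvDr, dotvNl, dotvNr, dotvZl, dotvZr) -!sqr_enorm (dotvC b a).
have ab0 := mulr_gt0 a0 b0; move=> ge0.
by rewrite -(ler_pM2l ab0); nra.
Qed.

Lemma normr_dotv_le a b : `|dotv a b| <= enorm a * enorm b.
Proof. by rewrite ler_norml lerNl -dotvNl -(enormN a) dotv_le enormN dotv_le. Qed.

Lemma ler_enormD a b : enorm (a + b) <= enorm a + enorm b.
Proof.
rewrite -(@ler_pXn2r _ 2) ?nnegrE ?addr_ge0 ?enorm_ge0//.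
rewrite sqr_enorm !(dotvDl, dotvDr) -!sqr_enorm (dotvC b a).
by have := dotv_le a b; nra.
Qed.

Lemma ler_enormB a b : enorm (a - b) <= enorm a + enorm b.
Proof. by rewrite (le_trans (ler_enormD _ _))// enormN. Qed.

Lemma ler_enorm_distD c a b : enorm (a - b) <= enorm (a - c) + enorm (c - b).
Proof. by rewrite (le_trans _ (ler_enormD _ _))// addrA subrK. Qed.

Lemma normr_le_enorm a : `|a| <= enorm a.
Proof.
rewrite /Num.norm/= mx_normrE; apply: bigmax_le => [|[i j] _]; first exact: enorm_ge0.
by rewrite ord1 coord_le_enorm.
Qed.

(** The factor [n.+1] is crude on purpose: it is positive for [n = 0] as well. *)
Lemma enorm_le_normr a : enorm a <= n.+1%:R * `|a|.
Proof.
have H (i : 'I_n) : `|a 0 i| <= `|a|.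
  rewrite [leRHS]/Num.norm/= mx_normrE.
  by rewrite (le_bigmax _ (fun ij : 'I_1 * 'I_n => `|a ij.1 ij.2|) (0, i)).
rewrite -[leRHS]ger0_norm// -sqrtr_sqr ler_wsqrtr// exprMn.
rewrite (@le_trans _ _ (\sum_(i < n) `|a| ^+ 2))//.
  by apply: ler_sum => i _; rewrite -expr2 -real_normK ?num_real// ler_pXn2r ?nnegrE.
rewrite sumr_const card_ord -[leLHS]mulr_natl ler_wpM2r ?sqr_ge0//.
by rewrite -natrX ler_nat expnS expn1 (leq_trans (leqnSn n))// leq_pmulr.
Qed.

(** Neighbourhoods are defined through the sup norm, which is equivalent to the
Euclidean one. *)
Lemma nbhs_enormP (a : 'rV[R]_n) (A : set 'rV[R]_n) :
  nbhs a A <-> exists2 d : R, 0 < d & forall b, enorm (b - a) < d -> A b.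
Proof.
have n0 : 0 < n.+1%:R :> R by rewrite ltr0n.
split=> [/nbhs_ballP[d /= d0]|[d d0 dA]].
  rewrite -ball_normE => dA.
  exists d => // b bad; apply: dA => /=.
  by rewrite distrC (le_lt_trans (normr_le_enorm _)).
apply/nbhs_ballP; exists (d / n.+1%:R) => /=; first by rewrite divr_gt0.
rewrite -ball_normE => b /=; rewrite distrC ltr_pdivlMr// mulrC => bad.
by apply: dA; rewrite (le_lt_trans (enorm_le_normr _)).
Qed.

Lemma cvg_enormP {T : Type} {F : set_system T} {FF : Filter F}
    (f : T -> 'rV[R]_n) a :
  (forall e, 0 < e -> \forall t \near F, enorm (f t - a) < e) -> f @ F --> a.
Proof.
move=> H A /nbhs_enormP[d d0 dA].
by apply: filterS (H _ d0) => t; apply: dA.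
Qed.

End Euclid.

(** * Real induction and right Dini derivatives *)

Section RealInduction.
Context {R : realType}.
Implicit Types (a b t u e : R) (P : R -> Prop) (h : R -> R).

Lemma near_rightP t P :
  (\forall u \near t^'+, P u) <->
  exists2 d, 0 < d & forall u, t < u < t + d -> P u.
Proof.
split=> [[d /= d0 H]|[d d0 H]]; exists d => //.
  move=> u /andP[tu utd]; apply: H => //=.
  by rewrite ltr0_norm ?subr_lt0// opprB ltrBlDl.
move=> u /= utd tu; apply: H; rewrite tu/= -ltrBlDl.
by rewrite -[ltLHS]gtr0_norm ?subr_gt0// distrC.
Qed.

(** Induction along a real interval, by completeness: the supremum of the points up
to which [P] holds is reached by the left hypothesis and cannot lie before [b] by
the right one. *)
Lemma real_induction P a b : a <= b -> P a ->
  (forall t, a <= t < b -> P t -> \forall u \near t^'+, P u) ->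
  (forall t, a < t <= b -> (forall u, a <= u < t -> P u) -> P t) -> P b.
Proof.
move=> ab Pa Pright Pleft.
pose S := [set t | a <= t <= b /\ forall u, a <= u <= t -> P u].
have Sa : S a.
  split; first by rewrite lexx ab.
  by move=> u au; have -> : u = a by apply/le_anti; rewrite andbC.
have Sub : ubound S b by move=> t [/andP[]].
set c := sup S.
have ac : a <= c by apply: ub_le_sup => //; exists b.
have cb : c <= b by apply: ge_sup => //; exists a.
have Pc_lt u : a <= u < c -> P u.
  move=> /andP[au uc]; have [||t St ut] := @sup_gt _ S u => //; first by exists a.
  by case: St => _; apply; rewrite au ltW.
have Pc : P c.
  have [<-//|aNc] := eqVneq a c.
  by apply: Pleft => //; rewrite lt_neqAle aNc ac.
have [<-//|cNb] := eqVneq c b.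
have cb' : c < b by rewrite lt_neqAle cNb.
have /near_rightP[d d0 H] : \forall u \near c^'+, P u by apply: Pright; rewrite ?ac.
pose e := Num.min (d / 2) (b - c).
have e0 : 0 < e by rewrite lt_min divr_gt0//= subr_gt0.
suff : c + e <= c by rewrite gerDl leNgt e0.
apply: ub_le_sup; first by exists b.
split=> [|u /andP[au uce]].
  rewrite (le_trans ac) ?lerDl ?(ltW e0)//=.
  by rewrite -lerBrDl ge_min lexx orbT.
have [uc|cu|->//] := ltgtP u c; first by apply: Pc_lt; rewrite au.
apply: H; rewrite cu/= (le_lt_trans uce)// ltrD2l gt_min.
by rewrite ltr_pdivrMr// ltr_pMr// ltr1n.
Qed.

(** Allowing a slope [e > 0], the inequality [h t <= h a + e (t - a)] propagates by
real induction; then [e] tends to [0].  The hypothesis from the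
left is lower semicontinuity. *)
Lemma right_dini_nonincreasing h a b : a <= b ->
  (forall t, a < t <= b -> forall e, 0 < e -> \forall s \near t^'-, h t <= h s + e) ->
  (forall t, a <= t < b -> forall e, 0 < e ->
     \forall s \near t^'+, h s <= h t + e * (s - t)) ->
  h b <= h a.
Proof.
move=> ab hleft hright.
suff H e : 0 < e -> h b <= h a + e * (b - a).
  apply/ler_addgt0Pr => e e0; have d0 : 0 < b - a + 1 by rewrite ltr_wpDl ?subr_ge0.
  rewrite (le_trans (H (e / (b - a + 1)) _)) ?divr_gt0// lerD2l.
  by rewrite mulrAC ler_pdivrMr// ler_pM2l// lerDl.
move=> e0; apply: (real_induction (P := fun t => h t <= h a + e * (t - a)) ab).
- by rewrite subrr mulr0 addr0.
- move=> t tab ht; apply: filterS (hright _ tab _ e0) => s hs; lra.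
- move=> t /andP[at_ tb] ht; apply/ler_addgt0Pr => e' e'0.
  have tab : a < t <= b by rewrite at_.
  near t^'- => s.
  have hs : h t <= h s + e' by near: s; exact: hleft.
  have st : s < t by near: s; exact: nbhs_left_lt.
  have as_ : a <= s by near: s; exact: nbhs_left_ge.
  have := ht s; rewrite as_ st => /(_ isT); nra.
Unshelve. all: by end_near. Qed.

End RealInduction.

(** * Mean value inequality for absolutely continuous curves *)

Section AbsContinuous.
Context {R : realType} {n : nat}.
Implicit Types (f : R -> 'rV[R]_n) (a b t e k : R).
Local Notation mu := (@lebesgue_measure R).

Lemma derivable_near_norm (V : normedModType R) (f : R -> V) t e :
  derivable f t 1 -> 0 < e ->
  \forall s \near t, `|f s - f t - (s - t) *: derive1 f t| <= e * `|s - t|.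
Proof.
move=> /cvg_ex[l fl] e0.
have -> : derive1 f t = l by rewrite derive1E; apply: cvg_lim.
have /cvgrPdist_lt/(_ _ e0) [d /= d0 H] := fl; exists d => // s /=.
rewrite distrC => st.
have [->|sNt] := eqVneq s t.
  by rewrite !subrr scale0r subr0 !normr0 mulr0.
have st0 : s - t != 0 by rewrite subr_eq0.
have /= := H (s - t); rewrite sub0r normrN st0 => /(_ st isT)/ltW.
rewrite scaler1 subrK distrC => He.
rewrite -(scale1r (f s - f t)) -(divff st0) -scalerA -scalerBr normrZ mulrC.
by rewrite ler_wpM2r.
Qed.

Lemma derivable_near f t e : derivable f t 1 -> 0 < e ->
  \forall s \near t, enorm (f s - f t - (s - t) *: derive1 f t) <= e * `|s - t|.
Proof.
move=> dft e0; have n0 : 0 < n.+1%:R :> R by rewrite ltr0n.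
have en0 : 0 < e / n.+1%:R by rewrite divr_gt0.
apply: filterS (derivable_near_norm dft en0) => s fs.
by rewrite (le_trans (enorm_le_normr _))// -ler_pdivlMl// mulrA (mulrC _ e).
Qed.

Lemma derive1_bound f t k : derivable f t 1 ->
  (\forall s \near t^'+, enorm (f s - f t) <= k * (s - t)) ->
  enorm (derive1 f t) <= k.
Proof.
move=> dft H; apply/ler_addgt0Pr => e e0.
have {}dft : \forall s \near t^'+,
    enorm (f s - f t - (s - t) *: derive1 f t) <= e * `|s - t|.
  exact: cvg_within (derivable_near dft e0).
near t^'+ => s.
have st : 0 < s - t by rewrite subr_gt0; near: s; exact: nbhs_right_gt.
have h1 : enorm (f s - f t) <= k * (s - t) by near: s.
have h2 : enorm (f s - f t - (s - t) *: derive1 f t) <= e * `|s - t| by near: s.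
have : enorm ((s - t) *: derive1 f t) <= (k + e) * (s - t).
  rewrite -(subKr (f s - f t) (_ *: _)) (le_trans (ler_enormB _ _))//.
  by move: h2; rewrite gtr0_norm// => h2; lra.
by rewrite enormZ gtr0_norm// mulrC ler_pM2r.
Unshelve. all: by end_near. Qed.

Lemma abs_continuous_sub f a b a' b' : a' <= a -> b <= b' ->
  abs_continuous a' b' f -> abs_continuous a b f.
Proof.
move=> aa bb H e /H[d d0 {}H]; exists d => // m s sab; apply: H => i.
by have [h1 h2 h3] := sab i; split=> //; [exact: le_trans h1|exact: le_trans bb].
Qed.

Lemma abs_continuous_dom (f g h : R -> 'rV[R]_n) (C a b : R) : 0 < C ->
  abs_continuous a b f -> abs_continuous a b g ->
  (forall s u, a <= s -> s <= u -> u <= b -> enorm (h u - h s) <=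
     C * (enorm (f u - f s) + enorm (g u - g s) + (u - s))) ->
  abs_continuous a b h.
Proof.
move=> C0 Hf Hg hfg e e0.
have e3 : 0 < e / (3 * C) by rewrite divr_gt0// mulr_gt0.
have [d1 d10 {}Hf] := Hf _ e3; have [d2 d20 {}Hg] := Hg _ e3.
exists (Num.min (Num.min d1 d2) (e / (3 * C))); first by rewrite !lt_min d10 d20.
move=> m s sab tr; rewrite !lt_min => /andP[/andP[ld1 ld2] ld3].
have {}Hf := Hf m s sab tr ld1; have {}Hg := Hg m s sab tr ld2.
apply: (@le_lt_trans _ _ (\sum_(i < m) C * (enorm (f (s i).2 - f (s i).1) +
    enorm (g (s i).2 - g (s i).1) + ((s i).2 - (s i).1)))).
  by apply: ler_sum => i _; have [h1 h2 h3] := sab i; exact: hfg.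
rewrite -mulr_sumr !big_split/= -!big_split/=.
rewrite [X in _ * X]big_split/= [X in _ * (X + _)]big_split/= mulrC -ltr_pdivlMr//.
have -> : e / C = e / (3 * C) + e / (3 * C) + e / (3 * C).
  by field; rewrite gt_eqF.
by rewrite ltrD// ltrD.
Qed.

End AbsContinuous.

Section MeanValue.
Context {R : realType} {n : nat}.
Implicit Types (f : R -> 'rV[R]_n) (a b t e k : R).
Local Notation mu := (@lebesgue_measure R).

Lemma negligible_open_cover (A : set R) e : mu.-negligible A -> 0 < e ->
  exists O : set R, [/\ open O, A `<=` O & (mu O < e%:E)%E].
Proof.
move=> [B [mB B0 AB]] e0.
have [|O [oO BO muO]] := @lebesgue_regularity_outer R B e mB _ e0.
  have : (mu B < +oo)%E by rewrite B0 ltry.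
  by move=> h; exact: h.
exists O; split=> //; first exact: subset_trans BO.
have mO : measurable O by exact: open_measurable.
rewrite -(setDUK BO) measureU//; last 2 first.
- exact: measurableD.
- by rewrite -subset0 => x [Bx [_ /(_ Bx)]].
have : (mu B + mu (O `\` B) < e%:E)%E by rewrite B0 add0e; exact: muO.
by move=> h; exact: h.
Qed.

(** Invariant for propagating a bound on [f] from [a] to [t]: the variation of [f]
is bounded by the slope [k] except on finitely many disjoint intervals inside the
open set [O].  Their total length is compared with the measure of [O] before [t],
not with that of [O], so that an interval can be appended without inspecting the
previous ones. *)
Definition covered_variation (O : set R) k f a t : Prop :=
  exists (m : nat) (s : nat -> R * R),
    [/\ forall i, (i < m)%N -> [/\ a <= (s i).1, (s i).1 <= (s i).2 & (s i).2 <= t],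
        forall i j, (i < j < m)%N -> (s i).2 <= (s j).1,
        ((\sum_(i < m) ((s i).2 - (s i).1))%:E <= mu (O `&` `]a, t[))%E &
        enorm (f t - f a) <= k * (t - a) + \sum_(i < m) enorm (f (s i).2 - f (s i).1)].

Lemma covered_variation_slope O k f a t u : open O -> 0 <= k -> a <= t -> t <= u ->
  enorm (f u - f t) <= k * (u - t) ->
  covered_variation O k f a t -> covered_variation O k f a u.
Proof.
move=> oO k0 at_ tu fut [m [s [sat sdis slen svar]]].
exists m, s; split => //.
- by move=> i /sat[h1 h2 h3]; split => //; exact: le_trans tu.
- apply: (le_trans slen); apply: le_measure; rewrite ?inE.
  + by apply: measurableI => //; exact: open_measurable.
  + by apply: measurableI => //; exact: open_measurable.
  + apply: setIS => x /=; rewrite !in_itv/= => /andP[-> xt].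
    exact: lt_le_trans tu.
- rewrite (le_trans (ler_enorm_distD (f t) _ _))//; nra.
Qed.

Lemma covered_variation_append O k f a t u : open O -> 0 <= k -> a <= t -> t < u ->
  `]t, u[ `<=` O ->
  covered_variation O k f a t -> covered_variation O k f a u.
Proof.
move=> oO k0 at_ tu tuO [m [s [sat sdis slen svar]]].
pose s' i := if (i < m)%N then s i else (t, u).
have s'E (i : 'I_m) : s' i = s i by rewrite /s' ltn_ord.
have s'm : s' m = (t, u) by rewrite /s' ltnn.
exists m.+1, s'; split.
- move=> i; rewrite ltnS leq_eqVlt => /orP[/eqP->|im]; rewrite ?s'm ?(ltW tu)//.
  rewrite /s' im; have [h1 h2 h3] := sat _ im; split => //.
  exact: le_trans (ltW tu).
- move=> i j /andP[ij]; rewrite ltnS leq_eqVlt => /orP[/eqP jm|jm].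
    by rewrite jm s'm /s' -jm ij/=; have [] := sat i; rewrite -?jm.
  rewrite /s' (ltn_trans ij jm) jm; apply: sdis; by rewrite ij.
- rewrite big_ord_recr/= s'm/=; under eq_bigr do rewrite s'E.
  have mO : measurable O by exact: open_measurable.
  apply: (@le_trans _ _ (mu ((O `&` `]a, t[) `|` `]t, u[))).
    rewrite measureU//; last 2 first.
    + exact: measurableI.
    + rewrite -subset0 => x [[_ /=]]; rewrite !in_itv/= => /andP[_ xt] /andP[tx _].
      by have := lt_trans xt tx; rewrite ltxx.
    have tuE : ((u - t)%:E <= mu `]t, u[)%E.
      by rewrite lebesgue_measure_itv/= lte_fin tu EFinB.
    by rewrite EFinD leeD//; exact: tuE.
  apply: le_measure; rewrite ?inE.
  + by apply: measurableU => //; exact: measurableI.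
  + exact: measurableI.
  + move=> x [[Ox]|xtu]; rewrite /= !in_itv/=.
      by move=> /andP[-> xt]; split => //; rewrite (lt_trans xt).
    split; first exact: tuO.
    by move: xtu; rewrite /= in_itv/= => /andP[tx ->]; rewrite (le_lt_trans at_).
- rewrite big_ord_recr/= s'm/=; under eq_bigr do rewrite s'E.
  rewrite (le_trans (ler_enorm_distD (f t) _ _))//; nra.
Qed.

(** The exceptional null set is covered by an open set [O] so small that, by
absolute continuity, the variation of [f] over disjoint intervals inside [O] is
less than [e].  Near a point outside [O] the derivative controls the increments of
[f]; near a point of [O] all small intervals lie in [O].
Real induction glues these local bounds into one for [f b - f a]. *)
Lemma abs_continuous_mean_value f a b k : a <= b -> 0 <= k ->
  abs_continuous a b f ->
  {ae mu, forall t, a <= t <= b -> derivable f t 1 /\ enorm (derive1 f t) <= k} ->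
  enorm (f b - f a) <= k * (b - a).
Proof.
move=> ab k0 fac fae.
suff H e : 0 < e -> enorm (f b - f a) <= (k + e) * (b - a) + e.
  apply/ler_addgt0Pr => e e0; have d0 : 0 < b - a + 1 by rewrite ltr_wpDl ?subr_ge0.
  rewrite (le_trans (H (e / (b - a + 1)) _)) ?divr_gt0//.
  rewrite mulrDl -addrA lerD2l -[X in _ + X]mulr1 -mulrDr.
  by rewrite -mulrA mulVf ?mulr1// gt_eqF.
move=> e0; have [d d0 Hd] := fac e e0.
have [ O [oO NO Od]] := negligible_open_cover fae d0.
have ke0 : 0 <= k + e by rewrite addr_ge0// ltW.
suff [m [s [sab sdis slen svar]]] : covered_variation O (k + e) f a b.
  rewrite (le_trans svar)// lerD2l; apply/ltW/Hd => [i|i j _ _ [x [/=]]|].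
  - exact: sab.
  - rewrite !in_itv/= => /andP[h1 h2] /andP[h3 h4]; apply: val_inj.
    have [ij|ji|//] := ltngtP (nat_of_ord i) (nat_of_ord j).
      have sij : (s i).2 <= (s j).1 by apply: sdis; rewrite ij/=.
      by have := lt_trans (le_lt_trans sij h3) h2; rewrite ltxx.
    have sji : (s j).2 <= (s i).1 by apply: sdis; rewrite ji/=.
    by have := lt_trans (le_lt_trans sji h1) h4; rewrite ltxx.
  - rewrite -lte_fin (le_lt_trans slen)// (le_lt_trans _ Od)//.
    have mO : measurable O by exact: open_measurable.
    by apply: le_measure; rewrite ?inE//; exact: measurableI.
have slope_or_cover t : a <= t <= b ->
    (\forall u \near t, enorm (f u - f t) <= (k + e) * `|u - t|) \/ nbhs t O.
  move=> tab; have [Ot|NOt] := pselect (O t).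
    by right; exact: open_nbhs_nbhs.
  left; have [ft fk] : derivable f t 1 /\ enorm (derive1 f t) <= k.
    by apply: contrapT => Nt; apply/NOt/NO => /(_ tab).
  apply: filterS (derivable_near ft e0) => u fu.
  have -> : f u - f t = (f u - f t - (u - t) *: derive1 f t) + (u - t) *: derive1 f t.
    by rewrite subrK.
  rewrite (le_trans (ler_enormD _ _))// mulrDl addrC lerD//.
  by rewrite enormZ mulrC ler_wpM2r.
apply: (real_induction (P := covered_variation O (k + e) f a) ab).
- exists 0%N, (fun=> (a, a)); split=> //.
  + have -> : \sum_(i < 0) ((a, a).2 - (a, a).1) = 0 by exact: big_ord0.
    exact: measure_ge0.
  + by rewrite !subrr mulr0 big_ord0 enorm0 addr0.
- move=> t /andP[at_ tb] Pt.
  have tab : a <= t <= b by rewrite at_ ltW.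
  have [good|[r /= r0 bad]] := slope_or_cover t tab.
  + near=> u; have tu : t < u by near: u; exact: nbhs_right_gt.
    apply: (covered_variation_slope oO ke0 at_ (ltW tu) _ Pt).
    rewrite -[u - t]gtr0_norm ?subr_gt0//; near: u; exact: cvg_within good.
  + apply/near_rightP; exists r => // u /andP[tu utr].
    apply: (covered_variation_append oO ke0 at_ tu _ Pt) => x /=.
    rewrite in_itv/= => /andP[tx xu]; apply: bad => /=.
    rewrite ltr0_norm ?subr_lt0//; lra.
- move=> t /andP[at_ tb] Pt.
  have tab : a <= t <= b by rewrite ltW.
  have [good|[r /= r0 bad]] := slope_or_cover t tab.
  + near t^'- => u; have ut : u < t by near: u; exact: nbhs_left_lt.
    have au : a <= u by near: u; exact: nbhs_left_ge.
    have {Pt}Pu := Pt u; apply: (covered_variation_slope oO ke0 au (ltW ut)).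
      rewrite enormBC -[t - u]gtr0_norm ?subr_gt0// distrC.
      near: u; exact: cvg_within good.
    by apply: Pu; rewrite au.
  + near t^'- => u; have ut : u < t by near: u; exact: nbhs_left_lt.
    have au : a <= u by near: u; exact: nbhs_left_ge.
    have tur : t - u < r by near: u; exact: nbhs_left_ltBl.
    have {Pt}Pu := Pt u; apply: (covered_variation_append oO ke0 au ut).
      move=> x /=; rewrite in_itv/= => /andP[ux xt]; apply: bad => /=.
      rewrite gtr0_norm ?subr_gt0//; lra.
    by apply: Pu; rewrite au.
Unshelve. all: by end_near. Qed.

End MeanValue.

(** * Gradients, convexity and the KL inequality *)

Section Gradient.
Context {R : realType}.

(** The difference quotients at [a] in the direction [b - a] are at most
[f b - f a] for steps in [(0, 1]], by convexity. *)
Lemma convex_tangent (V : normedModType R) (D : set V) (f : V -> R) (a b : V) :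
  convex_function (E := V) D f -> D a -> D b ->
  derivable (f : V -> R^o) a (b - a) ->
  f a + 'D_(b - a) (f : V -> R^o) a <= f b.
Proof.
move=> cf Da Db df; rewrite -lerBrDl /derive.
have /cvg_ex[l fl] := df.
have fl' : h^-1 *: ((f \o shift a) (h *: (b - a)) - f a) @[h --> (0 : R)^'+] --> l.
  exact: cvg_dnbhs_at_right.
rewrite (cvg_lim _ fl)//.
rewrite -(cvg_lim _ fl')//; apply: limr_le; first by apply/cvg_ex; exists l.
near=> h.
have h0 : 0 < h by near: h; exact: nbhs_right_gt.
have h1 : h <= 1 by near: h; exact: nbhs_right_le.
have hI : Itv.spec (@Itv.num_sem R) (Itv.Real `[0%Z, 1%Z]) h.
  by rewrite /= /Itv.num_sem/= num_real/= in_itv/= (ltW h0) h1.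
have {}cf : f (h *: b + (1 - h) *: a) <= h * f b + (1 - h) * f a.
  by apply: (cf (Itv.mk hI)); rewrite inE.
rewrite /=; have -> : h *: (b - a) + a = h *: b + (1 - h) *: a.
  by rewrite scalerBr scalerBl scale1r -addrA (addrC (- _)).
rewrite -[leLHS]/(h^-1 * _) ler_pdivrMl//; lra.
Unshelve. all: by end_near. Qed.

Context {n : nat}.
Implicit Types (f : 'rV[R]_n -> R) (a b : 'rV[R]_n) (e : R).

Lemma derive_grad f a b : differentiable (f : 'rV[R]_n -> R^o) a ->
  'D_b (f : 'rV[R]_n -> R^o) a = dotv (grad f a) b.
Proof.
move=> df; rewrite deriveE// [in LHS](row_sum_delta b) linear_sum.
apply: eq_bigr => i _.
by rewrite linearZ/= mxE deriveE// mulrC.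
Qed.

Lemma grad_near f a e : differentiable (f : 'rV[R]_n -> R^o) a -> 0 < e ->
  \forall b \near a, `|f b - f a - dotv (grad f a) (b - a)| <= e * enorm (b - a).
Proof.
move=> df e0.
have := diff_locally df => /eqaddoP/(_ _ e0)/nbhs_enormP[d d0 H].
apply/nbhs_enormP; exists d => // b bad.
have := H (b - a); rewrite subr0 => /(_ bad).
rewrite /= !fctE/= subrK => He.
rewrite -derive_grad// deriveE//; move: He; rewrite opprD addrA => He.
rewrite (le_trans He)// ler_wpM2l ?(ltW e0)//.
exact: normr_le_enorm.
Qed.

Lemma convex_grad_tangent f a b : convex_function (E := 'rV[R]_n) [set: 'rV[R]_n] f ->
  differentiable (f : 'rV[R]_n -> R^o) a -> f a + dotv (grad f a) (b - a) <= f b.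
Proof.
move=> cf df; rewrite -derive_grad//; apply: (convex_tangent cf) => //.
exact: diff_derivable.
Qed.

Lemma convex_grad_monotone f a b :
  convex_function (E := 'rV[R]_n) [set: 'rV[R]_n] f ->
  (forall a, differentiable (f : 'rV[R]_n -> R^o) a) ->
  0 <= dotv (grad f a - grad f b) (a - b).
Proof.
move=> cf df.
have := convex_grad_tangent a cf (df b); have := convex_grad_tangent b cf (df a).
by rewrite !(dotvDl, dotvDr, dotvNl, dotvNr); lra.
Qed.

Lemma gradD f (g : 'rV[R]_n -> R) a : differentiable (f : 'rV[R]_n -> R^o) a ->
  differentiable (g : 'rV[R]_n -> R^o) a ->
  grad (fun b => f b + g b) a = grad f a + grad g a.
Proof.
move=> df dg; apply/rowP => i; rewrite !mxE.
by rewrite -deriveD//; exact: diff_derivable.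
Qed.

(** The constant sequence at [a] is admissible, since a gradient is a Frechet
subgradient. *)
Lemma grad_limiting_subdiff f a : differentiable (f : 'rV[R]_n -> R^o) a ->
  limiting_subdiff (fun b => (f b)%:E) a (grad f a).
Proof.
move=> df; split=> //; exists (fun=> a), (fun=> grad f a); split => //.
- exact: cvg_cst.
- exact: cvg_cst.
- move=> _; split => // e e0; apply: filterS (grad_near df e0) => b.
  by rewrite ler_norml lee_fin => /andP[h1 h2]; lra.
- exact: cvg_cst.
Qed.

Lemma edist_limiting_subdiff_le f a : differentiable (f : 'rV[R]_n -> R^o) a ->
  (edist_set 0 (limiting_subdiff (fun b => (f b)%:E) a) <= (enorm (grad f a))%:E)%E.
Proof.
move=> df; apply: ereal_inf_lbound; exists (grad f a).
  exact: grad_limiting_subdiff.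
by rewrite sub0r enormN.
Qed.

(** This is what replaces the chain rule for [g] along a curve that is not known to be
differentiable. *)
Lemma concave_tangent (D : set R) (g : R -> R) (a b : R) :
  convex_function (E := R^o) D (fun s => - g s) -> D a -> D b ->
  derivable (g : R -> R^o) a 1 -> g b <= g a + derive1 (g : R -> R^o) a * (b - a).
Proof.
move=> cg Da Db dg.
have diffg : differentiable (g : R -> R^o) a by exact/derivable1_diffP.
have dgv : derivable (g : R -> R^o) a (b - a) by exact: diff_derivable.
have := convex_tangent cg Da Db (derivableN dgv).
rewrite deriveN// derive1E !deriveE// -{1}[b - a]mulr1 linearZ/=.
rewrite -[_ *: _]/(_ * _); lra.
Qed.

Lemma desingularizing_near (eta : \bar R) (g : R -> R) (y e : R) :
  desingularizing eta g -> 0 <= y -> (y%:E < eta)%E -> 0 < e ->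
  exists2 d, 0 < d & forall y', 0 <= y' -> (y'%:E < eta)%E -> `|y' - y| < d ->
    `|g y' - g y| < e.
Proof.
move=> [_ /subspace_continuousP cg _ _ _] y0 yeta e0.
have Dy : [set s : R | 0 <= s /\ (s%:E < eta)%E] y by [].
have /cvgrPdist_lt/(_ _ e0) [d /= d0 H] := cg y Dy.
exists d => // y' y'0 y'eta yd; rewrite distrC; apply: H => //=.
by rewrite distrC.
Qed.

(** The gradient belongs to the limiting subdifferential, so its norm bounds the
distance to [0] from above; the factor in front is positive. *)
Lemma KL_grad f a : (forall b, differentiable (f : 'rV[R]_n -> R^o) b) ->
  KL_property (fun b => (f b)%:E) a ->
  exists (eta : \bar R) (g : R -> R) (r : R),
    [/\ (0 < eta)%E, 0 < r, desingularizing eta g &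
      forall b, enorm (b - a) < r -> f a < f b -> ((f b - f a)%:E < eta)%E ->
        1 <= derive1 (g : R -> R^o) (f b - f a) * enorm (grad f b)].
Proof.
move=> df [eta [U [g [eta0 /nbhs_enormP[r r0 rU] desg H]]]].
exists eta, g, r; split => // b br fab fbeta.
have Hb : ((f b)%:E < (f a)%:E + eta)%E.
  by move: fbeta; rewrite EFinB lteBlDr// addeC.
have {}H := H b (rU _ br) fab Hb.
have g0 : 0 < derive1 (g : R -> R^o) (f b - f a).
  by case: desg => _ _ _ _ /(_ (f b - f a)); rewrite subr_gt0 => /(_ fab fbeta)[].
rewrite -lee_fin EFinM (le_trans H)//=.
apply: lee_wpmul2l; first by rewrite lee_fin ltW.
exact: edist_limiting_subdiff_le.
Qed.

End Gradient.

(** * Integrals on the half line and measurable derivatives *)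

#[local] Instance lebesgue_ae_filter (R : realType) :
  Filter (almost_everywhere (@lebesgue_measure R)) :=
  ae_filter_ringOfSetsType (@lebesgue_measure R).

Section HalfLineIntegrals.
Context {R : realType}.
Implicit Types (f G : R -> R) (C T s t e : R).
Local Notation mu := (@lebesgue_measure R).

Lemma lipschitz_continuous f C : (forall s t, `|f s - f t| <= C * `|s - t|) ->
  continuous f.
Proof.
move=> fC t; have C1 : 0 < `|C| + 1 by rewrite ltr_wpDl.
apply/cvgrPdist_lt => e e0; exists (e / (`|C| + 1)) => /=; first by rewrite divr_gt0.
move=> s /=; rewrite ltr_pdivlMr// mulrC; apply: le_lt_trans.
rewrite (le_trans (fC t s))// ler_wpM2r//.
by rewrite (le_trans (ler_norm C))// lerDl.
Qed.

Lemma integral_halfline_le f C : continuous f -> (forall t, 0 <= f t) ->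
  (forall T, 0 <= T -> (\int[mu]_(t in `[0%R, T]) (f t)%:E <= C%:E)%E) ->
  (\int[mu]_(t in `[0%R, +oo[) (f t)%:E <= C%:E)%E.
Proof.
move=> cf f0 fC.
have mf D : measurable_fun D (EFin \o f).
  by apply/measurable_EFinP; apply: measurable_funTS; exact: continuous_measurable_fun.
rewrite itv_bndy_bigcup_BRight.
pose I (k : nat) : set R := `[0, 0 + k%:R]%classic.
have Ind : nondecreasing_seq I.
  move=> i j ij; apply/subsetPset => t; rewrite /I/= !in_itv/= => /andP[-> ti].
  by rewrite (le_trans ti)// lerD2l ler_nat.
have mI i : measurable (I i) by exact: measurable_itv.
have f0' i t : I i t -> (0 <= (EFin \o f) t)%E by rewrite lee_fin.
have := ge0_nondecreasing_set_cvg_integral (mu := mu) Ind mI (fun i => mf (I i)) f0'.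
move=> /cvge_to_le; apply.
by apply: nearW => k; apply: fC; rewrite add0r.
Qed.

(** The integral starts at [- 1] so that [G] is differentiable at [0] from both
sides; the integral over [[0, T]] is then only bounded by [G T]. *)
Lemma continuous_antiderivative f : continuous f -> (forall t, 0 <= f t) ->
  exists G, forall T, 0 <= T ->
    [/\ derivable G T 1, derive1 G T = f T &
        (\int[mu]_(t in `[0%R, T]) (f t)%:E <= (G T)%:E)%E].
Proof.
move=> cf f0.
have mf D : measurable_fun D (EFin \o f).
  by apply/measurable_EFinP; apply: measurable_funTS; exact: continuous_measurable_fun.
have fint T : mu.-integrable `[-1, T]%classic (EFin \o f).
  apply: continuous_compact_integrable; first exact: segment_compact.
  exact: continuous_subspaceT.
exists (fun T => \int[mu]_(t in [set` Interval (BLeft (-1)) (BRight T)]) f t)%R.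
move=> T T0.
have T1 : T < T + 1 by rewrite ltrDl.
have H := continuous_FTC1 T1 (fint _).
have [|dG GE] := H _ (cf T).
  by rewrite lte_fin (lt_le_trans _ T0)// ltrN10.
split => //; rewrite /Rintegral fineK; last exact: integrable_fin_num.
apply: ge0_subset_integral => //.
- exact: mf.
- by move=> t _; rewrite lee_fin.
- move=> t /=; rewrite !in_itv/= => /andP[t0 ->]; rewrite andbT.
  by rewrite (le_trans _ t0)// lerN10.
Qed.

End HalfLineIntegrals.

Section DerivativeRepresentative.
Context {R : realType} {n : nat}.
Implicit Types (y : R -> 'rV[R]_n) (s t e : R).
Local Notation mu := (@lebesgue_measure R).

(** Composing with the absolute value extends a curve on the half line to a
continuous curve on the whole line. *)
Lemma coord_absr_continuous y (C : R) (i : 'I_n) :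
  (forall s t, 0 <= s -> 0 <= t -> enorm (y s - y t) <= C * `|s - t|) ->
  continuous ((fun t : R => y `|t| 0 i) : R -> R).
Proof.
move=> yC; apply: (@lipschitz_continuous _ _ `|C|) => s t.
have -> : y `|s| 0 i - y `|t| 0 i = (y `|s| - y `|t|) 0 i by rewrite !mxE.
rewrite (le_trans (coord_le_enorm _ _))// (le_trans (yC _ _ _ _))//.
rewrite (le_trans (ler_wpM2r _ (ler_norm C)))// ler_wpM2l//.
exact: ler_dist_dist.
Qed.

(** The upper limit of the difference quotients with steps [1 / (k + 1)] is a
measurable function of time, and agrees with the derivative where it exists. *)
Lemma derive1_measurable_repr y (C : R) :
  (forall s t, 0 <= s -> 0 <= t -> enorm (y s - y t) <= C * `|s - t|) ->
  exists g : R -> 'rV[R]_n,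
    (forall i, measurable_fun setT (fun t : R => g t 0 i)) /\
    forall t, 0 <= t -> derivable y t 1 -> derive1 y t = g t.
Proof.
move=> yC.
pose u (i : 'I_n) (k : nat) (t : R) : R :=
  k.+1%:R * (y `|t + k.+1%:R^-1| 0 i - y `|t| 0 i).
exists (fun t => \row_i fine (limn_esup (fun k => (u i k t)%:E))); split.
  move=> i; under eq_fun do rewrite mxE.
  apply: measurableT_comp; first exact: fine_measurable.
  apply: measurable_fun_limn_esup => k; apply/measurable_EFinP.
  apply: measurable_funM; first exact: measurable_cst.
  have cy := @coord_absr_continuous y C i yC.
  apply: measurable_funB; apply: continuous_measurable_fun; last exact: cy.
  move=> t; apply: (@continuous_comp _ _ _ (fun t => t + k.+1%:R^-1)
    (fun t => y `|t| 0 i)); last exact: cy.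
  by apply: continuousD => //; exact: cst_continuous.
move=> t t0 dyt; apply/rowP => i; rewrite mxE.
suff H : (fun k => u i k t) @ \oo --> derive1 y t 0 i.
  have H' : (fun k => (u i k t)%:E) @ \oo --> (derive1 y t 0 i)%:E.
    by apply: cvg_EFin => //; exact: nearW.
  rewrite is_cvg_limn_esupE; last by apply/cvg_ex; eexists; exact: H'.
  by move/cvg_lim : H' => ->.
apply/cvgrPdist_le => e e0.
have /near_rightP[d d0 H] : \forall s \near t^'+,
    enorm (y s - y t - (s - t) *: derive1 y t) <= e * `|s - t|.
  exact: cvg_within (derivable_near dyt e0).
have [N _ HN] := near_infty_natSinv_lt (PosNum d0).
exists N => // k Nk.
have k0 : 0 < k.+1%:R :> R by rewrite ltr0n.
have kV0 : 0 < k.+1%:R^-1 :> R by rewrite invr_gt0.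
have := H (t + k.+1%:R^-1); rewrite ltrDl kV0 ltrD2l => /(_ (HN _ Nk)).
have -> : t + k.+1%:R^-1 - t = k.+1%:R^-1 by rewrite addrAC subrr add0r.
rewrite gtr0_norm// => Hk.
rewrite /u (ger0_norm t0) (ger0_norm (addr_ge0 t0 (ltW kV0))) distrC.
set Y := derive1 y t in Hk *.
have := le_trans (coord_le_enorm _ i) Hk; rewrite !mxE => Hi.
have -> : k.+1%:R * (y (t + k.+1%:R^-1) 0 i - y t 0 i) - Y 0 i =
  k.+1%:R * (y (t + k.+1%:R^-1) 0 i - y t 0 i - k.+1%:R^-1 * Y 0 i).
  by field; rewrite gt_eqF.
by rewrite normrM gtr0_norm// mulrC -ler_pdivlMr.
Qed.

Lemma measurable_dotv (D : set R) (g h : R -> 'rV[R]_n) :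
  (forall i, measurable_fun D (fun t => g t 0 i)) ->
  (forall i, measurable_fun D (fun t => h t 0 i)) ->
  measurable_fun D (fun t => dotv (g t) (h t)).
Proof.
by move=> mg mh; apply: measurable_sum => i; exact: measurable_funM.
Qed.

End DerivativeRepresentative.

(** * Energy decrease along a descent trajectory *)

Section StronglyMonotone.
Context {R : realType} {n : nat} (x z : R -> 'rV[R]_n) (lam B : R).
Implicit Types (s t e : R).
Hypothesis lam_gt0 : 0 < lam.
Hypothesis B_gt0 : 0 < B.
Hypothesis z_lip : forall s t, 0 <= s -> 0 <= t -> enorm (z s - z t) <= B * `|s - t|.
Hypothesis zx_mono : forall s t, 0 <= s -> 0 <= t ->
  lam * enorm (x s - x t) ^+ 2 <= dotv (z s - z t) (x s - x t).

(** Cauchy-Schwarz on the right-hand side of strong monotonicity. *)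
Lemma strongly_monotone_le s t : 0 <= s -> 0 <= t -> lam * enorm (x s - x t) <= enorm (z s - z t).
Proof.
move=> s0 t0; have [x0|x0] := leP (enorm (x s - x t)) 0.
  by rewrite (le_trans _ (enorm_ge0 _))// pmulr_rle0.
rewrite -(ler_pM2r x0) -mulrA -expr2 (le_trans (zx_mono s0 t0))//.
exact: dotv_le.
Qed.

Lemma strongly_monotone_lipschitz s t : 0 <= s -> 0 <= t -> enorm (x s - x t) <= B / lam * `|s - t|.
Proof.
move=> s0 t0; rewrite mulrAC ler_pdivlMr// mulrC.
exact: le_trans (strongly_monotone_le s0 t0) (z_lip s0 t0).
Qed.

Lemma strongly_monotone_near_right t e : 0 <= t -> 0 < e ->
  \forall s \near t^'+, enorm (x s - x t) < e.
Proof.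
move=> t0 e0; apply/near_rightP; exists (e / (B / lam)); rewrite ?divr_gt0//.
move=> s /andP[ts]; rewrite -ltrBlDl ltr_pdivlMr ?divr_gt0// mulrC => std.
apply: le_lt_trans std; rewrite -[s - t]gtr0_norm ?subr_gt0//.
by apply: strongly_monotone_lipschitz; rewrite // (le_trans t0)// ltW.
Qed.

Lemma strongly_monotone_near_left t e : 0 < t -> 0 < e ->
  \forall s \near t^'-, enorm (x s - x t) < e.
Proof.
move=> t0 e0; near=> s.
have s0 : 0 <= s by near: s; exact: nbhs_left_ge.
have st : s < t by near: s; exact: nbhs_left_lt.
have ste : t - s < e / (B / lam).
  by near: s; apply: nbhs_left_ltBl; rewrite divr_gt0 ?divr_gt0.
rewrite (le_lt_trans (strongly_monotone_lipschitz s0 (ltW t0)))// distrC.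
rewrite gtr0_norm ?subr_gt0// mulrC.
by rewrite -ltr_pdivlMr ?divr_gt0.
Unshelve. all: by end_near. Qed.

End StronglyMonotone.

(** What remains of the differential system once null sets have been dealt with:
[z] is comparable with [x], and [z' = - F (x t)] as a right derivative at every
time, where [F] is the gradient of [Phi]. *)
Record descent_trajectory (R : realType) (n : nat) (Phi : 'rV[R]_n -> R)
    (F : 'rV[R]_n -> 'rV[R]_n) (x z : R -> 'rV[R]_n) (lam M K B : R) : Prop :=
  DescentTrajectory {
    descent_lam_gt0 : 0 < lam;
    descent_M_gt0 : 0 < M;
    descent_K_gt0 : 0 < K;
    descent_B_gt0 : 0 < B;
    descent_grad : forall (p : 'rV[R]_n) (e : R), 0 < e ->
      \forall q \near p, `|Phi q - Phi p - dotv (F p) (q - p)| <= e * enorm (q - p);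
    descent_lipschitz : elipschitz K F;
    descent_z_lipschitz : forall s t : R, 0 <= s -> 0 <= t ->
      enorm (z s - z t) <= B * `|s - t|;
    descent_z_derive : forall t e : R, 0 <= t -> 0 < e ->
      \forall s \near t^'+, enorm (z s - z t + (s - t) *: F (x t)) <= e * (s - t);
    descent_z_mono : forall s t : R, 0 <= s -> 0 <= t ->
      lam * enorm (x s - x t) ^+ 2 <= dotv (z s - z t) (x s - x t);
    descent_z_le_x : forall s t : R, 0 <= s -> 0 <= t ->
      enorm (z s - z t) <= M * enorm (x s - x t)
  }.

Section Trajectory.
Context {R : realType} {n : nat}.
Implicit Types (p q : 'rV[R]_n) (a b s t e k : R).
Context (Phi : 'rV[R]_n -> R) (F : 'rV[R]_n -> 'rV[R]_n) (x z : R -> 'rV[R]_n).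
Context (lam M K B : R).
Hypothesis traj : descent_trajectory Phi F x z lam M K B.

Let lam_gt0 : 0 < lam.
Proof. exact: descent_lam_gt0 traj. Qed.

Let M_gt0 : 0 < M.
Proof. exact: descent_M_gt0 traj. Qed.

Let K_gt0 : 0 < K.
Proof. exact: descent_K_gt0 traj. Qed.

Let B_gt0 : 0 < B.
Proof. exact: descent_B_gt0 traj. Qed.

Let F_grad : forall p e, 0 < e ->
  \forall q \near p, `|Phi q - Phi p - dotv (F p) (q - p)| <= e * enorm (q - p).
Proof. exact: descent_grad traj. Qed.

Let F_lip : elipschitz K F.
Proof. exact: descent_lipschitz traj. Qed.

Let z_lip : forall s t, 0 <= s -> 0 <= t -> enorm (z s - z t) <= B * `|s - t|.
Proof. exact: descent_z_lipschitz traj. Qed.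

Let z_deriv : forall t e, 0 <= t -> 0 < e ->
  \forall s \near t^'+, enorm (z s - z t + (s - t) *: F (x t)) <= e * (s - t).
Proof. exact: descent_z_derive traj. Qed.

Let zx_mono : forall s t, 0 <= s -> 0 <= t ->
  lam * enorm (x s - x t) ^+ 2 <= dotv (z s - z t) (x s - x t).
Proof. exact: descent_z_mono traj. Qed.

Let zx_lip : forall s t, 0 <= s -> 0 <= t ->
  enorm (z s - z t) <= M * enorm (x s - x t).
Proof. exact: descent_z_le_x traj. Qed.

Let x_le_z s t : 0 <= s -> 0 <= t -> lam * enorm (x s - x t) <= enorm (z s - z t).
Proof. exact: strongly_monotone_le. Qed.

Let x_lip s t : 0 <= s -> 0 <= t -> enorm (x s - x t) <= B / lam * `|s - t|.
Proof. exact: (strongly_monotone_lipschitz lam_gt0 z_lip). Qed.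

Let x_near_right t e : 0 <= t -> 0 < e -> \forall s \near t^'+, enorm (x s - x t) < e.
Proof. exact: (strongly_monotone_near_right lam_gt0 B_gt0 z_lip). Qed.

Let x_near_left t e : 0 < t -> 0 < e -> \forall s \near t^'-, enorm (x s - x t) < e.
Proof. exact: (strongly_monotone_near_left lam_gt0 B_gt0 z_lip). Qed.

Let c := lam / M ^+ 2.

Let rate_gt0 : 0 < c.
Proof. by rewrite divr_gt0 ?exprn_gt0. Qed.

Lemma F_x_lip s t : 0 <= s -> 0 <= t ->
  enorm (F (x s) - F (x t)) <= K * (B / lam) * `|s - t|.
Proof.
move=> s0 t0; rewrite (le_trans (F_lip _ _))// -mulrA ler_pM2l//.
exact: x_lip.
Qed.

Lemma Phi_near p e : 0 < e -> \forall q \near p, `|Phi q - Phi p| <= e.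
Proof.
move=> e0.
have k0 : 0 < enorm (F p) + 1 by rewrite ltr_wpDl// enorm_ge0.
have near_p : \forall q \near p, enorm (q - p) < e / (enorm (F p) + 1).
  by apply/nbhs_enormP; exists (e / (enorm (F p) + 1)); rewrite ?divr_gt0.
apply: filterS2 near_p (F_grad p ltr01) => q.
rewrite ltr_pdivlMr// mul1r => qe H.
rewrite -(subrK (dotv (F p) (q - p)) (_ - _)) (le_trans (ler_normD _ _))//.
have := normr_dotv_le (F p) (q - p); lra.
Qed.

Lemma energy_near_left t e : 0 < t -> 0 < e ->
  \forall s \near t^'-, `|Phi (x s) - Phi (x t)| <= e.
Proof.
move=> t0 e0; have /nbhs_enormP[d d0 H] := Phi_near (x t) e0.
by apply: filterS (x_near_left t0 d0) => s; exact: H.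
Qed.

(** Multiplying the first-order expansion of [Phi] by the step [d = s - t] replaces
[d *: F (x t)] by [- (z s - z t)]; monotonicity bounds the result by
[- lam |x s - x t| ^ 2], which is at most [- c |z s - z t| ^ 2], that is
[- c d ^ 2 |F (x t)| ^ 2] to leading order.  Dividing by [d] gives the claim. *)
Lemma energy_dini t e : 0 <= t -> 0 < e ->
  \forall s \near t^'+,
    Phi (x s) <= Phi (x t) - c * enorm (F (x t)) ^+ 2 * (s - t) + e * (s - t).
Proof.
move=> t0 e0; set N := enorm (F (x t)).
have N0 : 0 <= N by exact: enorm_ge0.
have c0 := rate_gt0.
(* [e1 * D] bounds all error terms, per unit of time. *)
pose D := 2 * (N + 1) / lam + 2 * c * N.
have D0 : 0 < D.
  have : 0 <= 2 * c * N by apply: mulr_ge0 => //; rewrite pmulr_rge0// ltW.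
  have : 0 < 2 * (N + 1) / lam by rewrite divr_gt0// mulr_gt0// ltr_wpDl.
  by rewrite /D; lra.
pose e1 := Num.min 1 (e / D).
have e10 : 0 < e1 by rewrite lt_min ltr01 divr_gt0.
have e11 : e1 <= 1 by rewrite ge_min lexx.
have e1D : e1 * D <= e by rewrite -ler_pdivlMr// ge_min lexx orbT.
have /nbhs_enormP[r r0 Hr] := F_grad (x t) e10.
near=> s.
have st : t < s by near: s; exact: nbhs_right_gt.
have s0 : 0 <= s by rewrite (le_trans t0) ?ltW.
have xst : enorm (x s - x t) < r by near: s; exact: x_near_right.
have zst : enorm (z s - z t + (s - t) *: F (x t)) <= e1 * (s - t).
  by near: s; exact: z_deriv.
have {Hr} := Hr _ xst.
have := zx_mono s0 t0; have := zx_lip s0 t0; have := x_le_z s0 t0.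
set y := x s - x t; set w := z s - z t; set d := s - t in zst *.
have d0 : 0 < d by rewrite subr_gt0.
have Y0 := enorm_ge0 y; set Y := enorm y in Y0 *.
have W0 := enorm_ge0 w; set W := enorm w in W0 *.
have Wup : W <= d * N + e1 * d.
  rewrite /W -(addrK (d *: F (x t)) w) (le_trans (ler_enormB _ _))//.
  by rewrite enormZ gtr0_norm// -/N addrC lerD2l; exact: zst.
have Wlo : d * N - e1 * d <= W.
  have : d * N <= e1 * d + W; last by lra.
  rewrite -{1}[d]gtr0_norm// -enormZ -(addrK w (d *: F (x t))).
  by rewrite (le_trans (ler_enormB _ _))// lerD2r addrC.
have Fy : d * dotv (F (x t)) y <= e1 * d * Y - dotv w y.
  have : dotv (w + d *: F (x t)) y <= e1 * d * Y.
    by rewrite (le_trans (dotv_le _ _))// ler_wpM2r.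
  by rewrite dotvDl dotvZl; lra.
move=> YW WM mono /ler_normlP[_ taylor].
have cW : c * W ^+ 2 <= lam * Y ^+ 2.
  rewrite /c mulrAC ler_pdivrMr ?exprn_gt0// -mulrA ler_pM2l//.
  by rewrite -exprMn ler_pXn2r ?nnegrE// ?mulr_ge0 ?(ltW M_gt0)// mulrC.
have WN : d ^+ 2 * (N ^+ 2 - 2 * e1 * N) <= W ^+ 2.
  have [Ne|Ne] := leP e1 N.
    have h : 0 <= d * N - e1 * d by nra.
    have : (d * N - e1 * d) ^+ 2 <= W ^+ 2 by rewrite ler_pXn2r ?nnegrE.
    nra.
  rewrite (@le_trans _ _ 0) ?sqr_ge0// mulr_ge0_le0 ?sqr_ge0//.
  by have := mulr_ge0 N0 (ltW e10); nra.
have Yd : Y <= d * (N + e1) / lam by rewrite ler_pdivlMr// mulrC; lra.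
have dY : d * (Phi (x s) - Phi (x t)) <= 2 * e1 * d * Y - c * (d ^+ 2 * (N ^+ 2 - 2 * e1 * N)).
  have := ler_wpM2l (ltW c0) WN; nra.
have dY2 : 2 * e1 * d * Y <= 2 * e1 * d * (d * (N + 1) / lam).
  rewrite ler_wpM2l ?mulr_ge0 ?(ltW d0) ?(ltW e10)//.
  by rewrite (le_trans Yd)// ler_pM2r ?invr_gt0// ler_pM2l// lerD2l.
rewrite -(ler_pM2l d0).
have : d * d * (e1 * D) <= d * d * e by rewrite ler_wpM2l// mulr_ge0 ?ltW.
have -> : d * d * (e1 * D) = 2 * e1 * d * (d * (N + 1) / lam) + c * d ^+ 2 * (2 * e1 * N).
  by rewrite /D; field; rewrite gt_eqF.
nra.
Unshelve. all: by end_near. Qed.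

(** The increments of [G] stand for a lower bound on the dissipated energy. *)
Lemma energy_decrease (G : R -> R) a b : 0 <= a -> a <= b ->
  (forall t, a < t <= b -> forall e, 0 < e -> \forall s \near t^'-, G t <= G s + e) ->
  (forall t, a <= t < b -> forall e, 0 < e -> \forall s \near t^'+,
     G s <= G t + c * enorm (F (x t)) ^+ 2 * (s - t) + e * (s - t)) ->
  Phi (x b) + G b <= Phi (x a) + G a.
Proof.
move=> a0 ab Gleft Gright.
apply: (right_dini_nonincreasing (h := fun t => Phi (x t) + G t) ab) => t tab e e0.
- have e2 : 0 < e / 2 by rewrite divr_gt0.
  have t0 : 0 < t by case/andP: tab => [+ _]; exact: le_lt_trans.
  apply: filterS2 (energy_near_left t0 e2) (Gleft _ tab _ e2) => s.
  by move=> /ler_normlP[h1 h2] h3; lra.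
- have e2 : 0 < e / 2 by rewrite divr_gt0.
  have t0 : 0 <= t by case/andP: tab => [+ _]; exact: le_trans.
  apply: filterS2 (energy_dini t0 e2) (Gright _ tab _ e2) => s h1 h2; lra.
Qed.

Lemma energy_decrease_const k a b : 0 <= k -> 0 <= a -> a <= b ->
  (forall t, a <= t <= b -> k <= enorm (F (x t)) ^+ 2) ->
  Phi (x b) <= Phi (x a) - c * k * (b - a).
Proof.
move=> k0 a0 ab kF; have c0 := rate_gt0.
have ck0 : 0 <= c * k by rewrite mulr_ge0// ltW.
have ck1 : 0 < c * k + 1 by rewrite ltr_wpDl.
suff : Phi (x b) + c * k * (b - a) <= Phi (x a) + c * k * (a - a) by lra.
apply: (energy_decrease (G := fun t => c * k * (t - a))) => // t tab e e0.
- near=> s.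
  have st : s < t by near: s; exact: nbhs_left_lt.
  have : t - s < e / (c * k + 1) by near: s; apply: nbhs_left_ltBl; rewrite divr_gt0.
  rewrite ltr_pdivlMr//; nra.
- near=> s; have ts : t < s by near: s; exact: nbhs_right_gt.
  have : c * k <= c * enorm (F (x t)) ^+ 2.
    by rewrite ler_pM2l// kF//; case/andP: tab => -> /ltW.
  nra.
Unshelve. all: by end_near. Qed.

Lemma energy_nonincreasing a b : 0 <= a -> a <= b -> Phi (x b) <= Phi (x a).
Proof.
move=> a0 ab; rewrite (le_trans (energy_decrease_const (lexx 0) a0 ab _)) ?mulr0 ?mul0r ?subr0//.
by move=> t _; exact: sqr_ge0.
Qed.

Context (l : R).
Hypothesis Phi_ge : forall t, 0 <= t -> l <= Phi (x t).
Hypothesis Phi_lt : forall e, 0 < e ->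
  exists2 T, 0 <= T & forall t, T <= t -> Phi (x t) < l + e.

(** If [|F (x t)| >= e] then, [F (x t)] being Lipschitz in [t], it stays above [e / 2]
for a fixed time [d], during which the energy drops by a fixed gap; near the
limit energy [l] this is impossible. *)
Lemma grad_x_cvg0 e : 0 < e ->
  exists2 T, 0 <= T & forall t, T <= t -> enorm (F (x t)) < e.
Proof.
move=> e0; have c0 := rate_gt0.
have KB0 : 0 < K * (B / lam) by rewrite mulr_gt0 ?divr_gt0.
pose d := e / 2 / (K * (B / lam)).
have d0 : 0 < d by rewrite !divr_gt0.
have gap0 : 0 < c * (e / 2) ^+ 2 * d by rewrite pmulr_lgt0// pmulr_rgt0// exprn_gt0// divr_gt0.
have [T T0 HT] := Phi_lt gap0; exists T => // t Tt.
have t0 : 0 <= t by exact: le_trans Tt.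
rewrite ltNge; apply/negP => eF.
have td : t <= t + d by rewrite lerDl ltW.
have := energy_decrease_const (sqr_ge0 (e / 2)) t0 td.
have := HT _ Tt; have := Phi_ge (le_trans t0 td).
rewrite addrAC subrr add0r => h1 h2; suff H s : t <= s <= t + d ->
  (e / 2) ^+ 2 <= enorm (F (x s)) ^+ 2 by move=> /(_ H); lra.
move=> /andP[ts std]; have s0 := le_trans t0 ts.
rewrite ler_pXn2r ?nnegrE ?enorm_ge0 ?divr_ge0 ?(ltW e0)//.
have : enorm (F (x s) - F (x t)) <= e / 2.
  rewrite (le_trans (F_x_lip s0 t0))// ger0_norm ?subr_ge0//.
  by rewrite mulrC -ler_pdivlMr// lerBlDl.
have := ler_enorm_distD (F (x s)) (F (x t)) 0; rewrite !subr0 enormBC; lra.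
Qed.

(** A nonzero gradient would push the energy below its infimum. *)
Lemma critical_at_limit s t : 0 <= t -> t <= s -> Phi (x t) = l ->
  Phi (x s) = l /\ F (x t) = 0.
Proof.
move=> t0 ts Ptl; have Pl u : t <= u -> Phi (x u) = l.
  move=> tu; apply/le_anti; rewrite Phi_ge ?(le_trans t0)// andbT -Ptl.
  exact: energy_nonincreasing.
split; first exact: Pl.
apply: enorm_le0_eq0; rewrite leNgt; apply/negP => F0; have c0 := rate_gt0.
have e0 : 0 < c * enorm (F (x t)) ^+ 2 / 2 by rewrite divr_gt0// pmulr_rgt0// exprn_gt0.
near t^'+ => u.
have tu : t < u by near: u; exact: nbhs_right_gt.
have : Phi (x u) <= Phi (x t) - c * enorm (F (x t)) ^+ 2 * (u - t) +
    c * enorm (F (x t)) ^+ 2 / 2 * (u - t).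
  by near: u; exact: energy_dini.
rewrite Ptl (Pl u (ltW tu)); nra.
Unshelve. all: by end_near. Qed.

(** * Integrability of the velocities *)

Local Notation mu := (@lebesgue_measure R).
Let half := (`[0, +oo[%classic : set R).

Let half_ge0 t : half t -> 0 <= t.
Proof. by rewrite /half/= in_itv/= andbT. Qed.

Let energy_rate t := enorm (F (x `|t|)) ^+ 2.

Let energy_rateE t : half t -> energy_rate t = enorm (F (x t)) ^+ 2.
Proof. by move=> /half_ge0 t0; rewrite /energy_rate ger0_norm. Qed.

Lemma energy_rate_continuous : continuous energy_rate.
Proof.
have cF : continuous (fun t => enorm (F (x `|t|))).
  apply: (@lipschitz_continuous _ _ (K * (B / lam))) => s t.
  have dFx : enorm (F (x `|s|) - F (x `|t|)) <= K * (B / lam) * `|s - t|.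
    rewrite (le_trans (F_x_lip _ _))// ler_wpM2l ?ler_dist_dist//.
    by rewrite mulr_ge0 ?divr_ge0 ?ltW.
  rewrite (le_trans _ dFx)// ler_norml; apply/andP; split.
    have := ler_enorm_distD (F (x `|s|)) (F (x `|t|)) 0.
    by rewrite !subr0 (enormBC (F (x `|t|))); lra.
  by have := ler_enorm_distD (F (x `|t|)) (F (x `|s|)) 0; rewrite !subr0; lra.
by move=> t; exact: (cvgM (cF t) (cF t)).
Qed.

Let energy_rate_measurable : measurable_fun half (EFin \o energy_rate).
Proof.
apply/measurable_EFinP; apply: measurable_funTS.
by apply: continuous_measurable_fun; exact: energy_rate_continuous.
Qed.

(** With [G] an antiderivative of the rate, [Phi (x T) + c G T] is nonincreasing. *)
Lemma energy_rate_integral : (\int[mu]_(t in half) (energy_rate t)%:E < +oo)%E.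
Proof.
have c0 := rate_gt0.
have N0 t : 0 <= energy_rate t by exact: sqr_ge0.
have [G HG] := continuous_antiderivative energy_rate_continuous N0.
apply: (@le_lt_trans _ _ ((Phi (x 0) - l) / c + G 0)%:E); last exact: ltry.
apply: integral_halfline_le => //; first exact: energy_rate_continuous.
move=> T T0; have [_ _ /le_trans] := HG T T0; apply; rewrite lee_fin.
suff H : Phi (x T) + c * G T <= Phi (x 0) + c * G 0.
  rewrite -lerBlDr ler_pdivlMr//; have := Phi_ge T0; lra.
apply: (energy_decrease (G := fun t => c * G t)) => // t /andP[t0 tT] e e0.
  have [dG GE _] := HG t (ltW t0).
  have : \forall s \near t^'-, `|G t - G s| < e / c.
    apply: cvg_within.
    have cG : {for t, continuous G} by apply/differentiable_continuous/derivable1_diffP.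
    by move/cvgrPdist_lt : cG; apply; rewrite divr_gt0.
  apply: filterS => s /ltr_normlP[_]; rewrite ltr_pdivlMr//; lra.
have [dG GE _] := HG t t0.
have e'0 : 0 < e / c by rewrite divr_gt0.
have near_right P : (\forall s \near t, P s) -> \forall s \near t^'+, P s.
  exact: cvg_within.
near=> s; have ts : t < s by near: s; exact: nbhs_right_gt.
have : `|G s - G t - (s - t) *: derive1 G t| <= e / c * `|s - t|.
  by near: s; apply: near_right; exact: derivable_near_norm.
rewrite GE energy_rateE; last by rewrite /half/= in_itv/= andbT.
rewrite (gtr0_norm (_ : 0 < s - t)) ?subr_gt0// => /ler_normlP[_].
rewrite -[_ *: _]/(_ * _) => /(ler_wpM2l (ltW c0)).
have -> : c * (e / c * (s - t)) = e * (s - t) by field; rewrite gt_eqF.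
lra.
Unshelve. all: by end_near. Qed.

Lemma in_L2_dominated (f g : R -> 'rV[R]_n) k : 0 <= k ->
  ae_eq mu half f g -> (forall i, measurable_fun setT (fun t => g t 0 i)) ->
  {ae mu, forall t, half t -> enorm (f t) <= k * enorm (F (x t))} ->
  in_L2_pos f.
Proof.
move=> k0 fg mg fF; exists g; split => //.
  by move=> i; exact: measurable_funTS.
have mk : measurable_fun half (fun t => (k ^+ 2 * energy_rate t)%:E).
  apply/measurable_EFinP/measurable_funM => //.
  by apply/measurable_EFinP; exact: energy_rate_measurable.
apply: (@le_lt_trans _ _ (\int[mu]_(t in half) (k ^+ 2 * energy_rate t)%:E)%E).
  apply: ae_ge0_le_integral => //.
  - by move=> t _; rewrite lee_fin sqr_ge0.
  - apply/measurable_EFinP.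
    apply: (eq_measurable_fun (fun t => dotv (g t) (g t))) => [t _|].
      by rewrite /= sqr_enorm.
    by apply: measurable_dotv => i; exact: measurable_funTS.
  - by move=> t _; rewrite lee_fin mulr_ge0 ?sqr_ge0.
  apply: filterS2 fg fF => t fgt fFt ht; rewrite -fgt// lee_fin energy_rateE// -exprMn.
  by rewrite ler_pXn2r ?nnegrE ?mulr_ge0 ?enorm_ge0// fFt.
under eq_integral do rewrite EFinM.
rewrite ge0_integralZl//.
- by rewrite lte_mul_pinfty ?lee_fin ?sqr_ge0// energy_rate_integral.
- exact: measurable_itv.
- by move=> t _; rewrite lee_fin sqr_ge0.
- by rewrite lee_fin sqr_ge0.
Qed.

Lemma in_L1_dominated (f g : R -> R) k : 0 <= k ->
  ae_eq mu half f g -> measurable_fun setT g ->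
  {ae mu, forall t, half t -> `|f t| <= k * enorm (F (x t)) ^+ 2} ->
  in_L1_pos f.
Proof.
move=> k0 fg mg fF; exists g => //.
have mg' : measurable_fun half (EFin \o g).
  by apply/measurable_EFinP; exact: measurable_funTS.
apply/integrableP; split => //.
have mk : measurable_fun half (fun t => (k * energy_rate t)%:E).
  apply/measurable_EFinP/measurable_funM => //.
  by apply/measurable_EFinP; exact: energy_rate_measurable.
apply: (@le_lt_trans _ _ (\int[mu]_(t in half) (k * energy_rate t)%:E)%E).
  apply: ae_ge0_le_integral => //.
  - exact: measurableT_comp.
  - by move=> t _; rewrite lee_fin mulr_ge0 ?sqr_ge0.
  apply: filterS2 fg fF => t fgt fFt ht; rewrite /= -fgt// lee_fin energy_rateE//.
  exact: fFt.
under eq_integral do rewrite EFinM.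
rewrite ge0_integralZl//.
- by rewrite lte_mul_pinfty// energy_rate_integral.
- exact: measurable_itv.
- by move=> t _; rewrite lee_fin sqr_ge0.
Qed.

Lemma F_x_in_L2 : in_L2_pos (fun t => F (x t)).
Proof.
apply: (@in_L2_dominated _ (fun t => F (x `|t|)) 1) => //.
- by apply: aeW => t /half_ge0 t0; rewrite ger0_norm.
- move=> i; apply: continuous_measurable_fun.
  exact: (coord_absr_continuous (y := F \o x) F_x_lip).
- by apply: aeW => t _; rewrite mul1r.
Qed.

Lemma derive_le_F (y : R -> 'rV[R]_n) k t : 0 <= k -> 0 <= t ->
  (forall s, 0 <= s -> enorm (y s - y t) <= k * enorm (z s - z t)) ->
  derivable y t 1 -> enorm (derive1 y t) <= k * enorm (F (x t)).
Proof.
move=> k0 t0 yz dy; apply/ler_addgt0Pr => e e0.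
have k1 : 0 < k + 1 by rewrite ltr_wpDl.
have e'0 : 0 < e / (k + 1) by rewrite divr_gt0.
apply: derive1_bound => //; near=> s.
have ts : t < s by near: s; exact: nbhs_right_gt.
have st0 : 0 < s - t by rewrite subr_gt0.
have zst : enorm (z s - z t + (s - t) *: F (x t)) <= e / (k + 1) * (s - t).
  by near: s; exact: z_deriv.
have zst2 : enorm (z s - z t) <= (enorm (F (x t)) + e / (k + 1)) * (s - t).
  rewrite -(addrK ((s - t) *: F (x t)) (z s - z t)) (le_trans (ler_enormB _ _))//.
  by rewrite enormZ gtr0_norm//; lra.
rewrite (le_trans (yz _ (le_trans t0 (ltW ts))))//.
rewrite (le_trans (ler_wpM2l k0 zst2))// mulrA ler_pM2r// mulrDr lerD2l.
by rewrite mulrA ler_pdivrMr// mulrC ler_pM2l// lerDl.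
Unshelve. all: by end_near. Qed.

Section Velocity.
Context (y : R -> 'rV[R]_n) (k : R).
Hypothesis k_ge0 : 0 <= k.
Hypothesis y_le_z : forall s t, 0 <= s -> 0 <= t ->
  enorm (y s - y t) <= k * enorm (z s - z t).

Lemma derive1_cvg0 :
  derive1 y t @[t --> within [set s | derivable y s 1] (pinfty_nbhs R)]
    --> (0 : 'rV[R]_n).
Proof.
apply: cvg_enormP => e e0; rewrite near_withinE.
have k1 : 0 < k + 1 by rewrite ltr_wpDl.
have [T T0 HT] := grad_x_cvg0 (divr_gt0 e0 k1).
near=> t => /= dyt.
have Tt : T <= t by near: t; apply: nbhs_pinfty_ge; exact: num_real.
have t0 : 0 <= t by exact: le_trans Tt.
rewrite subr0 (le_lt_trans (derive_le_F k_ge0 t0 _ dyt))//.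
  by move=> s s0; exact: y_le_z.
have := HT t Tt; rewrite ltr_pdivlMr// mulrC; apply: le_lt_trans.
by rewrite ler_wpM2r ?enorm_ge0// lerDl.
Unshelve. all: by end_near. Qed.

Hypothesis y_derivable : {ae mu, forall t, 0 <= t -> derivable y t 1}.

Lemma derive1_ae_le_F :
  {ae mu, forall t, half t -> enorm (derive1 y t) <= k * enorm (F (x t))}.
Proof.
apply: filterS y_derivable => t dyt /half_ge0 t0; apply: derive_le_F => //; last exact: dyt.
by move=> s s0; exact: y_le_z.
Qed.

Lemma derive1_repr : exists g : R -> 'rV[R]_n,
  (forall i, measurable_fun setT (fun t : R => g t 0 i)) /\ ae_eq mu half (derive1 y) g.
Proof.
have yC s t : 0 <= s -> 0 <= t -> enorm (y s - y t) <= k * B * `|s - t|.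
  move=> s0 t0; rewrite (le_trans (y_le_z s0 t0))// -mulrA ler_wpM2l//.
  exact: z_lip.
have [g [mg yg]] := derive1_measurable_repr yC; exists g; split => //.
by apply: filterS y_derivable => t dyt /half_ge0 t0; apply: yg => //; exact: dyt.
Qed.

Lemma derive1_in_L2 : in_L2_pos (derive1 y).
Proof.
have [g [mg yg]] := derive1_repr.
exact: in_L2_dominated yg mg derive1_ae_le_F.
Qed.

End Velocity.

Lemma derive1_dot_in_L1 (y1 y2 : R -> 'rV[R]_n) k1 k2 : 0 <= k1 -> 0 <= k2 ->
  (forall s t, 0 <= s -> 0 <= t -> enorm (y1 s - y1 t) <= k1 * enorm (z s - z t)) ->
  (forall s t, 0 <= s -> 0 <= t -> enorm (y2 s - y2 t) <= k2 * enorm (z s - z t)) ->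
  {ae mu, forall t, 0 <= t -> derivable y1 t 1} ->
  {ae mu, forall t, 0 <= t -> derivable y2 t 1} ->
  in_L1_pos (fun t => dotv (derive1 y1 t) (derive1 y2 t)).
Proof.
move=> k10 k20 y1z y2z dy1 dy2.
have [g1 [mg1 yg1]] := derive1_repr k10 y1z dy1.
have [g2 [mg2 yg2]] := derive1_repr k20 y2z dy2.
apply: (@in_L1_dominated _ (fun t => dotv (g1 t) (g2 t)) (k1 * k2)).
- by rewrite mulr_ge0.
- by apply: filterS2 yg1 yg2 => t h1 h2 ht; rewrite h1// h2.
- exact: measurable_dotv.
apply: filterS2 (derive1_ae_le_F k10 y1z dy1) (derive1_ae_le_F k20 y2z dy2) => t h1 h2 ht.
rewrite (le_trans (normr_dotv_le _ _))// expr2 mulrACA.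
by apply: ler_pM; rewrite ?enorm_ge0// ?h1 ?h2.
Qed.

Lemma F_x_cvg0 : F (x t) @[t --> +oo] --> (0 : 'rV[R]_n).
Proof.
apply: cvg_enormP => e e0; have [T T0 HT] := grad_x_cvg0 e0.
near=> t; rewrite subr0; apply: HT.
by near: t; apply: nbhs_pinfty_ge; exact: num_real.
Unshelve. all: by end_near. Qed.

(** Along times at which [x t] approaches [p], the energy tends to [l] and the gradient
to [0]. *)
Lemma cluster_critical p :
  (forall e T, 0 < e -> exists2 t, T <= t & enorm (x t - p) < e) ->
  Phi p = l /\ F p = 0.
Proof.
move=> clp; split.
  apply/eqP; rewrite -subr_eq0 -normr_le0; apply/ler_addgt0Pr => e e0.
  have e2 : 0 < e / 2 by rewrite divr_gt0.
  have /nbhs_enormP[d d0 Hd] := Phi_near p e2.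
  have [T T0 HT] := Phi_lt e2; have [t Tt xtp] := clp _ T d0.
  have := HT t Tt; have := Phi_ge (le_trans T0 Tt); have /ler_normlP[] := Hd _ xtp.
  by rewrite add0r ler_norml; lra.
apply: enorm_le0_eq0; apply/ler_addgt0Pr => e e0; rewrite add0r.
have e2 : 0 < e / 2 by rewrite divr_gt0.
have [T T0 HT] := grad_x_cvg0 e2.
have [t Tt] := clp _ T (divr_gt0 e2 K_gt0); rewrite ltr_pdivlMr// mulrC => xtp.
have := ler_enorm_distD (F p) (F (x t)) 0; rewrite (enormBC _ (F p)) !subr0.
have := ler_enormD (F p - F (x t)) (F (x t)); rewrite subrK.
have := F_lip p (x t); rewrite (enormBC p).
have := HT t Tt; lra.
Qed.

(** * Convergence under the KL inequality *)

Context (xbar : 'rV[R]_n) (eta : \bar R) (g : R -> R) (r : R).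
Hypothesis Phi_xbar : Phi xbar = l.
Hypothesis eta_gt0 : (0 < eta)%E.
Hypothesis r_gt0 : 0 < r.
Hypothesis desg : desingularizing eta g.
Hypothesis KL_xbar : forall p, enorm (p - xbar) < r -> Phi xbar < Phi p ->
  ((Phi p - Phi xbar)%:E < eta)%E ->
  1 <= derive1 (g : R -> R^o) (Phi p - Phi xbar) * enorm (F p).

(** The factor [c * lam] is the largest for which the decrease of the second term
compensates the growth of the distance. *)
Let q t1 t := c * lam * enorm (x t - x t1) + g (Phi (x t) - l).

Lemma lyapunov_near_left t1 t e : 0 <= t1 -> t1 < t ->
  ((Phi (x t1) - l)%:E < eta)%E -> 0 < e ->
  \forall s \near t^'-, q t1 t <= q t1 s + e.
Proof.
move=> t10 t1t t1eta e0; have c0 := rate_gt0.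
have cl0 : 0 < c * lam by rewrite mulr_gt0.
have t0 : 0 < t by exact: le_lt_trans t1t.
have heta s : t1 <= s -> ((Phi (x s) - l)%:E < eta)%E.
  move=> t1s; apply: le_lt_trans t1eta.
  by rewrite lee_fin lerD2r energy_nonincreasing.
have h0 s : t1 <= s -> 0 <= Phi (x s) - l.
  by move=> t1s; rewrite subr_ge0 Phi_ge// (le_trans t10).
have e2 : 0 < e / 2 by rewrite divr_gt0.
have [d d0 Hd] := desingularizing_near desg (h0 _ (ltW t1t)) (heta _ (ltW t1t)) e2.
have d2 : 0 < d / 2 by rewrite divr_gt0.
near=> s.
have t1s : t1 <= s by near: s; exact: nbhs_left_ge.
have hs : `|Phi (x s) - Phi (x t)| <= d / 2 by near: s; exact: energy_near_left.
have xs : enorm (x s - x t) < e / 2 / (c * lam).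
  by near: s; apply: x_near_left; rewrite ?divr_gt0.
have : `|g (Phi (x s) - l) - g (Phi (x t) - l)| < e / 2.
  apply: Hd; [exact: h0|exact: heta|].
  have -> : Phi (x s) - l - (Phi (x t) - l) = Phi (x s) - Phi (x t) by ring.
  by rewrite (le_lt_trans hs)// ltr_pdivrMr// ltr_pMr// ltr1n.
move=> /ltr_normlP[hg _].
have := ler_enorm_distD (x s) (x t) (x t1); rewrite (enormBC (x t) (x s)) => tri.
move: xs; rewrite ltr_pdivlMr// => xs.
by rewrite /q; have := ler_wpM2l (ltW cl0) tri; lra.
Unshelve. all: by end_near. Qed.

(** If the energy is above [l], the tangent to the concave [g] at the current energy
and the KL inequality [g' |F| >= 1] give a decrease of [g] at rate [c |F|], while
[lam |x s - x t| <= |z s - z t|] lets the distance term grow at rate [c |F|] at most.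
If the energy is already [l], it stays there, the gradient vanishes, and neither
term changes to first order. *)
Lemma lyapunov_dini t1 t e : 0 <= t1 -> t1 <= t -> enorm (x t - xbar) < r ->
  ((Phi (x t1) - l)%:E < eta)%E -> 0 < e ->
  \forall s \near t^'+, q t1 s <= q t1 t + e * (s - t).
Proof.
move=> t10 t1t xtr t1eta e0; have c0 := rate_gt0.
have cl0 : 0 < c * lam by rewrite mulr_gt0.
have t0 : 0 <= t by exact: le_trans t1t.
have heta s : t1 <= s -> ((Phi (x s) - l)%:E < eta)%E.
  move=> t1s; apply: le_lt_trans t1eta.
  by rewrite lee_fin lerD2r energy_nonincreasing.
have h0 s : t1 <= s -> 0 <= Phi (x s) - l.
  by move=> t1s; rewrite subr_ge0 Phi_ge// (le_trans t10).
set N := enorm (F (x t)).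
have N0 : 0 <= N by exact: enorm_ge0.
have dist e' : 0 < e' -> \forall s \near t^'+,
    c * lam * enorm (x s - x t1) <=
    c * lam * enorm (x t - x t1) + c * (N + e') * (s - t).
  move=> e'0; near=> s.
  have ts : t < s by near: s; exact: nbhs_right_gt.
  have zst : enorm (z s - z t + (s - t) *: F (x t)) <= e' * (s - t).
    by near: s; exact: z_deriv.
  have st0 : 0 < s - t by rewrite subr_gt0.
  have zst2 : enorm (z s - z t) <= (N + e') * (s - t).
    rewrite -(addrK ((s - t) *: F (x t)) (z s - z t)) (le_trans (ler_enormB _ _))//.
    by rewrite enormZ gtr0_norm// -/N; lra.
  have xst := le_trans (x_le_z (le_trans t0 (ltW ts)) t0) zst2.
  have := ler_enorm_distD (x t) (x s) (x t1).
  move=> /(ler_wpM2l (ltW cl0)); have := ler_wpM2l (ltW c0) xst; lra.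
have [hle|hpos] := leP (Phi (x t)) l.
  have hE : Phi (x t) = l by apply/le_anti; rewrite hle Phi_ge.
  have F0 : N = 0.
    by rewrite /N; have [_ ->] := critical_at_limit t0 (lexx t) hE; rewrite enorm0.
  near=> s; have ts : t < s by near: s; exact: nbhs_right_gt.
  have [hs _] := critical_at_limit t0 (ltW ts) hE.
  rewrite /q hE hs.
  have : c * lam * enorm (x s - x t1) <=
      c * lam * enorm (x t - x t1) + c * (N + e / c) * (s - t).
    by near: s; apply: dist; rewrite divr_gt0.
  by rewrite F0 add0r [c * (e / c)]mulrC divfK ?gt_eqF//; lra.
have ht0 : 0 < Phi (x t) - l by rewrite subr_gt0.
have [cg _ _ _ /(_ _ ht0 (heta _ t1t))[dg _ g'0]] := desg.
have := KL_xbar xtr; rewrite Phi_xbar => /(_ hpos (heta _ t1t)).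
set g' := derive1 _ _ in g'0 * => KLt.
near=> s; have ts : t < s by near: s; exact: nbhs_right_gt.
have st0 : 0 < s - t by rewrite subr_gt0.
have t1s : t1 <= s by rewrite (le_trans t1t)// ltW.
have : c * lam * enorm (x s - x t1) <=
    c * lam * enorm (x t - x t1) + c * (N + e / 2 / c) * (s - t).
  by near: s; apply: dist; rewrite divr_gt0// divr_gt0.
have -> : c * (N + e / 2 / c) = c * N + e / 2 by field; rewrite gt_eqF.
have en : Phi (x s) <= Phi (x t) - c * N ^+ 2 * (s - t) + e / 2 / g' * (s - t).
  by near: s; apply: energy_dini; rewrite ?divr_gt0.
have gs : g (Phi (x s) - l) <= g (Phi (x t) - l) +
    g' * ((Phi (x s) - l) - (Phi (x t) - l)).
  apply: (concave_tangent cg) => //; split; first exact: h0.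
  - exact: heta.
  - exact: h0.
  - exact: heta.
have g'e : g' * (Phi (x s) - Phi (x t)) <= - c * N * (s - t) + e / 2 * (s - t).
  have := ler_wpM2l (ltW g'0) en.
  have : c * N * (s - t) * 1 <= c * N * (s - t) * (g' * N).
    by rewrite ler_wpM2l// mulr_ge0 ?(ltW st0)// mulr_ge0// ltW.
  have -> : g' * (Phi (x t) - c * N ^+ 2 * (s - t) + e / 2 / g' * (s - t)) =
    g' * Phi (x t) - c * N * (s - t) * (g' * N) + e / 2 * (s - t).
    by field; rewrite gt_eqF.
  lra.
by rewrite /q; lra.
Unshelve. all: by end_near. Qed.

(** While the trajectory is in the ball, the Lyapunov function does not increase, so the
distance to the starting point is at most the initial value of [g] over
[c * lam]; this is strictly inside the ball, so the trajectory never exits. *)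
Lemma trajectory_trapped t1 r' t : 0 <= t1 -> t1 <= t -> r' <= r ->
  ((Phi (x t1) - l)%:E < eta)%E ->
  enorm (x t1 - xbar) + g (Phi (x t1) - l) / (c * lam) < r' ->
  enorm (x t - xbar) < r'.
Proof.
move=> t10 t1t r'r t1eta start; have c0 := rate_gt0.
have cl0 : 0 < c * lam by rewrite mulr_gt0.
have heta s : t1 <= s -> ((Phi (x s) - l)%:E < eta)%E.
  move=> t1s; apply: le_lt_trans t1eta.
  by rewrite lee_fin lerD2r energy_nonincreasing.
have h0 s : t1 <= s -> 0 <= Phi (x s) - l.
  by move=> t1s; rewrite subr_ge0 Phi_ge// (le_trans t10).
have g0 s : t1 <= s -> 0 <= g (Phi (x s) - l).
  move=> t1s; have [_ _ _ + _] := desg; apply; split; [exact: h0|exact: heta].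
apply: (real_induction (P := fun t => enorm (x t - xbar) < r') t1t).
- apply: le_lt_trans start; rewrite lerDl divr_ge0 ?(ltW cl0)//; exact: g0.
- move=> s /andP[t1s _] xs; have s0 : 0 <= s by exact: le_trans t1s.
  have d0 : 0 < r' - enorm (x s - xbar) by rewrite subr_gt0.
  apply: filterS (x_near_right s0 d0) => u xu.
  by rewrite (le_lt_trans (ler_enorm_distD (x s) _ _))//; lra.
- move=> s /andP[t1s _] xu.
  have : q t1 s <= q t1 t1.
    apply: right_dini_nonincreasing (ltW t1s) _ _ => u /andP[h1 h2] e e0.
      exact: lyapunov_near_left.
    by apply: lyapunov_dini => //; rewrite (lt_le_trans _ r'r)// xu// h1.
  rewrite /q subrr enorm0 mulr0 add0r; have := g0 s (ltW t1s).
  have := ler_enorm_distD (x t1) (x s) xbar.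
  move=> tri gs qs; rewrite (le_lt_trans tri)// (le_lt_trans _ start)//.
  by rewrite addrC lerD2l ler_pdivlMr// mulrC; lra.
Qed.

Hypothesis xbar_cluster : forall e T, 0 < e ->
  exists2 t, T <= t & enorm (x t - xbar) < e.

Lemma trajectory_cvg e : 0 < e ->
  exists2 T, 0 <= T & forall t, T <= t -> enorm (x t - xbar) < e.
Proof.
move=> e0; have c0 := rate_gt0.
have cl0 : 0 < c * lam by rewrite mulr_gt0.
pose r' := Num.min e r.
have r'0 : 0 < r' by rewrite lt_min e0.
have r'2 : 0 < r' / 2 by rewrite divr_gt0.
have gr : 0 < r' / 2 * (c * lam) by rewrite mulr_gt0.
have [d d0 Hd] := desingularizing_near desg (lexx 0) eta_gt0 gr.
have [d' d'0 Hd'] : exists2 d' : R, 0 < d' & (d'%:E <= eta)%E.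
  case: eta eta_gt0 => [y y0|_|//]; first by exists y.
  by exists 1; rewrite ?leey.
pose m := Num.min d d'.
have m0 : 0 < m by rewrite lt_min d0.
have [T T0 HT] := Phi_lt m0.
have [t1 Tt1 xt1] := xbar_cluster T r'2.
have t10 : 0 <= t1 by exact: le_trans Tt1.
have hm : Phi (x t1) - l < m by rewrite ltrBlDl HT.
have h0 : 0 <= Phi (x t1) - l by rewrite subr_ge0 Phi_ge.
have heta : ((Phi (x t1) - l)%:E < eta)%E.
  by rewrite (lt_le_trans _ Hd')// lte_fin (lt_le_trans hm)// ge_min lexx orbT.
exists t1 => // t t1t.
have r'e : r' <= e by rewrite ge_min lexx.
apply: lt_le_trans r'e; apply: (trajectory_trapped t10 t1t) => //.
  by rewrite ge_min lexx orbT.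
have := Hd _ h0 heta; rewrite subr0 ger0_norm//.
have [_ _ -> _ _] := desg; rewrite subr0 => gd.
have : g (Phi (x t1) - l) < r' / 2 * (c * lam).
  rewrite (le_lt_trans (ler_norm _))// gd//.
  by rewrite (lt_le_trans hm)// ge_min lexx.
rewrite -ltr_pdivrMr// => h; lra.
Qed.

End Trajectory.

(** * Strong solutions are descent trajectories *)

Lemma bounded_cluster (R : realType) (n : nat) (x : R -> 'rV[R]_n) (M : R) :
  (forall t, 0 <= t -> enorm (x t) <= M) ->
  exists p, forall e T : R, 0 < e -> exists2 t, T <= t & enorm (x t - p) < e.
Proof.
move=> xM; pose A : set 'rV[R]_n := [set a | `|a| <= M].
have cA : compact A.
  apply: bounded_closed_compact.
    exists M; split; first exact: num_real.
    by move=> r Mr a /= /le_trans; apply; exact: ltW.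
  apply: (@closed_comp _ _ (fun a : 'rV[R]_n => `|a|) [set r | r <= M]).
    by move=> a _; exact: norm_continuous.
  exact: closed_le.
have xA : \forall t \near +oo%R, A (x t).
  near=> t; have t0 : 0 <= t by near: t; apply: nbhs_pinfty_ge; exact: num_real.
  by rewrite /A/= (le_trans (normr_le_enorm _))// xM.
have [p [_ clp]] := cA (x @ +oo%R) _ xA; exists p => e T e0.
have pe : nbhs p [set q | enorm (q - p) < e] by apply/nbhs_enormP; exists e.
have xT : \forall t \near +oo%R, [set x t | t in [set t | T <= t]] (x t).
  near=> t; have Tt : T <= t by near: t; apply: nbhs_pinfty_ge; exact: num_real.
  by exists t.
have [_ [[t Tt <-] xte]] := clp _ _ xT pe.
by exists t.
Unshelve. all: by end_near. Qed.

Lemma inf_tail (R : realType) (h : R -> R) (m : R) :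
  (forall t, 0 <= t -> m <= h t) ->
  (forall a b, 0 <= a -> a <= b -> h b <= h a) ->
  exists l, (forall t, 0 <= t -> l <= h t) /\
    forall e, 0 < e -> exists2 T, 0 <= T & forall t, T <= t -> h t < l + e.
Proof.
move=> hm hdec; pose S := h @` [set t | 0 <= t].
have S0 : S !=set0 by exists (h 0), 0 => //=.
have Sm : has_lbound S by exists m => _ [t /= t0 <-]; exact: hm.
exists (inf S); split=> [t t0|e e0]; first by apply: ge_inf => //; exists t.
have [_ [T /= T0 <-] hT] := inf_adherent e0 (conj S0 Sm).
exists T => // t Tt; exact: le_lt_trans (hdec _ _ T0 Tt) hT.
Qed.

Section StrongSolution.
Context {R : realType} {n : nat}.
Context (phi psi : 'rV[R]_n -> R) (rho L lambda : R) (x0 v0 : 'rV[R]_n).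
Context (x v : R -> 'rV[R]_n).
Hypothesis rho_gt0 : 0 < rho.
Hypothesis L_gt0 : 0 < L.
Hypothesis lambda_gt0 : 0 < lambda.
Hypothesis phi_convex : convex_function (E := 'rV[R]_n) [set: 'rV[R]_n] phi.
Hypothesis phi_diff : forall a : 'rV[R]_n, differentiable (phi : 'rV[R]_n -> R^o) a.
Hypothesis phi_lip : elipschitz rho^-1 (grad phi).
Hypothesis psi_diff : forall a : 'rV[R]_n, differentiable (psi : 'rV[R]_n -> R^o) a.
Hypothesis psi_lip : elipschitz L (grad psi).
Hypothesis xv_sol : strong_global_solution phi psi lambda x0 v0 x v.
Implicit Types (s t e k T : R).

Let Phi a := phi a + psi a.
Let F a := grad phi a + grad psi a.
Let z t := lambda *: x t + v t.
Local Notation mu := (@lebesgue_measure R).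

Lemma Phi_differentiable a : differentiable (Phi : 'rV[R]_n -> R^o) a.
Proof. exact: differentiableD. Qed.

Lemma grad_Phi a : grad Phi a = F a.
Proof. exact: gradD. Qed.

Lemma F_lipschitz : elipschitz (rho^-1 + L) F.
Proof.
move=> a b; rewrite /F opprD addrACA (le_trans (ler_enormD _ _))// mulrDl.
by rewrite lerD.
Qed.

Lemma v_le_x s t : 0 <= s -> 0 <= t -> enorm (v s - v t) <= rho^-1 * enorm (x s - x t).
Proof. by move=> s0 t0; have [_ vE _ _] := xv_sol; rewrite !vE. Qed.

Lemma z_mono s t : 0 <= s -> 0 <= t ->
  lambda * enorm (x s - x t) ^+ 2 <= dotv (z s - z t) (x s - x t).
Proof.
move=> s0 t0; have [_ vE _ _] := xv_sol.
rewrite /z opprD addrACA -scalerBr dotvDl dotvZl -sqr_enorm lerDl !vE//.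
exact: convex_grad_monotone.
Qed.

Lemma z_le_x s t : 0 <= s -> 0 <= t ->
  enorm (z s - z t) <= (lambda + rho^-1) * enorm (x s - x t).
Proof.
move=> s0 t0; rewrite /z opprD addrACA -scalerBr (le_trans (ler_enormD _ _))//.
by rewrite mulrDl lerD ?v_le_x// enormZ gtr0_norm.
Qed.

Lemma z_shift_derive (w : 'rV[R]_n) t : derivable x t 1 -> derivable v t 1 ->
  derivable (fun s => z s + s *: w) t 1 /\
  derive1 (fun s => z s + s *: w) t = lambda *: derive1 x t + derive1 v t + w.
Proof.
move=> dx dv.
have dZ := derivableZ (k := lambda) dx.
have dz := derivableD dZ dv.
have dw : differentiable ( *:%R ^~ w : R -> 'rV[R]_n) t by exact: ex_diff.
have dw1 : derivable ( *:%R ^~ w : R -> 'rV[R]_n) t 1 by exact: diff_derivable.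
split; first exact: (derivableD dz dw1).
rewrite !derive1E.
have -> : (fun s => z s + s *: w) = lambda \*: x + v + *:%R ^~ w by [].
rewrite (deriveD dz dw1) (deriveD dZ dv) (deriveZ lambda dx); congr (_ + _).
by rewrite deriveE// diff_val scale1r.
Qed.

Lemma z_shift_abs_continuous (w : 'rV[R]_n) T : 0 < T ->
  abs_continuous 0 T (fun s => z s + s *: w).
Proof.
move=> T0; have [[ax av] _ _ _] := xv_sol.
apply: (@abs_continuous_dom _ _ x v _ (lambda + 1 + enorm w)) => //.
- by rewrite ltr_wpDr ?enorm_ge0// addr_gt0.
- exact: ax.
- exact: av.
move=> s u _ su _.
have -> : z u + u *: w - (z s + s *: w) =
    lambda *: (x u - x s) + (v u - v s) + (u - s) *: w.
  by rewrite /z scalerBr scalerBl !opprD !addrA; apply/rowP => i; rewrite !mxE; ring.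
rewrite (le_trans (ler_enormD _ _))// enormZ ger0_norm ?subr_ge0//.
have := ler_enormD (lambda *: (x u - x s)) (v u - v s); rewrite enormZ gtr0_norm//.
have := enorm_ge0 (x u - x s); have := enorm_ge0 (v u - v s); have := enorm_ge0 w.
have : 0 <= u - s by rewrite subr_ge0.
set a := enorm (x u - x s); set b := enorm (v u - v s); set d := u - s.
set c := enorm w; move=> d0 c0 b0 a0 h.
have := mulr_ge0 c0 a0; have := mulr_ge0 c0 b0.
have := mulr_ge0 (ltW lambda_gt0) d0; have := mulr_ge0 (ltW lambda_gt0) b0.
lra.
Qed.

(** The shift by [s *: w] turns an oscillation bound on [F (x u)] around a constant
vector [w] into a bound on the derivative. *)
Lemma z_mean_value (w : 'rV[R]_n) t s k : 0 <= k -> 0 <= t -> t <= s ->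
  (forall u, t <= u <= s -> enorm (w - F (x u)) <= k) ->
  enorm (z s - z t + (s - t) *: w) <= k * (s - t).
Proof.
move=> k0 t0 ts wF.
have -> : z s - z t + (s - t) *: w = z s + s *: w - (z t + t *: w).
  by rewrite scalerBl (opprD (z t) (t *: w)) [RHS]addrACA.
have T0 : 0 < s + 1 by rewrite ltr_wpDl// (le_trans t0).
have sT : s <= s + 1 by rewrite lerDl.
apply: (abs_continuous_mean_value (f := fun u => z u + u *: w) ts k0).
  exact: abs_continuous_sub t0 sT (z_shift_abs_continuous w T0).
have [_ vE sol _] := xv_sol.
apply: filterS sol => u solu /andP[tu us].
have u0 : 0 <= u by exact: le_trans tu.
have [dx dv sys] := solu u0; have [dz ->] := z_shift_derive w dx dv; split => //.
have -> : lambda *: derive1 x u + derive1 v u + w = w - F (x u).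
  move: sys; rewrite vE// -addrA -/(F (x u)) => /eqP.
  by rewrite addr_eq0 => /eqP ->; rewrite addrC.
by apply: wF; rewrite tu.
Qed.

Hypothesis x_bounded : exists M : R, forall t : R, 0 <= t -> enorm (x t) <= M.

Lemma z_lipschitz : exists2 B, 0 < B &
  forall s t, 0 <= s -> 0 <= t -> enorm (z s - z t) <= B * `|s - t|.
Proof.
have [M xM] := x_bounded.
have M0 : 0 <= M by rewrite (le_trans (enorm_ge0 (x 0)))// xM.
have K0 : 0 < rho^-1 + L by rewrite addr_gt0 ?invr_gt0.
pose B := enorm (F 0) + (rho^-1 + L) * M + 1.
have B0 : 0 < B by rewrite ltr_wpDl// addr_ge0 ?enorm_ge0// mulr_ge0// ltW.
exists B => //.
have FB u : 0 <= u -> enorm (0 - F (x u)) <= B.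
  move=> u0; rewrite sub0r enormN.
  have := ler_enorm_distD (F (x u)) (F 0) 0; have := F_lipschitz (x u) 0.
  have := ler_wpM2l (ltW K0) (xM u u0); rewrite !subr0 /B.
  have := ler_enormD (F (x u) - F 0) (F 0); rewrite subrK; lra.
suff H s t : 0 <= t -> t <= s -> enorm (z s - z t) <= B * `|s - t|.
  move=> s t s0 t0; have [st|/ltW ts] := leP t s; first exact: H.
  by rewrite enormBC distrC; exact: H.
move=> t0 ts; rewrite ger0_norm ?subr_ge0//.
have := @z_mean_value 0 t s B (ltW B0) t0 ts; rewrite scaler0 addr0; apply.
by move=> u /andP[tu _]; apply: FB; exact: le_trans tu.
Qed.

Lemma z_right_derivative t e : 0 <= t -> 0 < e ->
  \forall s \near t^'+, enorm (z s - z t + (s - t) *: F (x t)) <= e * (s - t).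
Proof.
move=> t0 e0; have [B B0 zB] := z_lipschitz.
have K0 : 0 < rho^-1 + L by rewrite addr_gt0 ?invr_gt0.
have eK0 : 0 < e / (rho^-1 + L) by rewrite divr_gt0.
have /near_rightP[d d0 xd] :=
  strongly_monotone_near_right lambda_gt0 B0 zB z_mono t0 eK0.
apply/near_rightP; exists d => // s /andP[ts sd].
apply: z_mean_value => //; [exact: ltW|exact: ltW|move=> u /andP[tu us]].
have [->|tNu] := eqVneq u t; first by rewrite subrr enorm0 ltW.
rewrite enormBC (le_trans (F_lipschitz _ _))// mulrC -ler_pdivlMr// ltW//.
by apply: xd; rewrite lt_neqAle eq_sym tNu tu (le_lt_trans us).
Qed.

Lemma strong_solution_descent : exists B,
  descent_trajectory Phi F x z lambda (lambda + rho^-1) (rho^-1 + L) B.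
Proof.
have [B B_gt0 z_lip] := z_lipschitz; exists B; split => //.
- by rewrite addr_gt0 ?invr_gt0.
- by rewrite addr_gt0 ?invr_gt0.
- by move=> p e e0; rewrite -grad_Phi; apply: grad_near => //; exact: Phi_differentiable.
- exact: F_lipschitz.
- exact: z_right_derivative.
- exact: z_mono.
- exact: z_le_x.
Qed.

End StrongSolution.

Theorem theorem13 (R : realType) (n : nat) (phi psi : 'rV[R]_n -> R)
    (rho L lambda : R) (x0 v0 : 'rV[R]_n) (x v : R -> 'rV[R]_n)
    (rho_gt0 : 0 < rho) (L_gt0 : 0 < L) (lambda_gt0 : 0 < lambda)
    (phi_convex : convex_function (E := 'rV[R]_n) [set: 'rV[R]_n] phi)
    (phi_diff : forall a : 'rV[R]_n, differentiable (phi : 'rV[R]_n -> R^o) a)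
    (phi_lip : elipschitz rho^-1 (grad phi))
    (psi_diff : forall a : 'rV[R]_n, differentiable (psi : 'rV[R]_n -> R^o) a)
    (psi_lip : elipschitz L (grad psi))
    (v0E : v0 = grad phi x0)
    (xv_sol : strong_global_solution phi psi lambda x0 v0 x v)
    (KL : KL_function (fun a : 'rV[R]_n => (phi a + psi a)%:E))
    (bounded_below : exists m : R, forall a, m <= phi a + psi a)
    (x_bounded : exists M : R, forall t : R, 0 <= t -> enorm (x t) <= M) :
  (* (i) *)
  ([/\ in_L2_pos (derive1 x), in_L2_pos (derive1 v) &
       in_L2_pos (fun t => grad phi (x t) + grad psi (x t))] /\
   in_L1_pos (fun t => dotv (derive1 x t) (derive1 v t)) /\
   [/\ derive1 x t @[t --> within [set s | derivable x s 1] (pinfty_nbhs R)] --> (0 : 'rV[R]_n),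
       derive1 v t @[t --> within [set s | derivable v s 1] (pinfty_nbhs R)] --> (0 : 'rV[R]_n) &
       grad phi (x t) + grad psi (x t) @[t --> +oo] --> (0 : 'rV[R]_n)]) /\
  (* (ii) *)
  (exists xbar : 'rV[R]_n,
    grad (fun a => phi a + psi a) xbar = 0 /\
    x t @[t --> +oo] --> xbar).
Proof.
pose Phi a := phi a + psi a; pose F a := grad phi a + grad psi a.
pose z t := lambda *: x t + v t.
have Phi_diff := Phi_differentiable phi_diff psi_diff.
have gradE a : grad Phi a = F a by exact: gradD.
have [B traj] : exists B,
    descent_trajectory Phi F x z lambda (lambda + rho^-1) (rho^-1 + L) B.
  exact: strong_solution_descent xv_sol x_bounded.
have [m mPhi] := bounded_below.
have [l [Phi_ge Phi_lt]] :=
  inf_tail (h := Phi \o x) (fun t _ => mPhi (x t)) (energy_nonincreasing traj).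
have x_le_z s t : 0 <= s -> 0 <= t -> enorm (x s - x t) <= lambda^-1 * enorm (z s - z t).
  move=> s0 t0; rewrite ler_pdivlMl//.
  exact: strongly_monotone_le lambda_gt0 (descent_z_mono traj) _ _ s0 t0.
have v_le_z s t : 0 <= s -> 0 <= t ->
    enorm (v s - v t) <= rho^-1 * lambda^-1 * enorm (z s - z t).
  move=> s0 t0; rewrite (le_trans (v_le_x phi_lip xv_sol s0 t0))// -mulrA.
  by rewrite ler_pM2l ?invr_gt0//; exact: x_le_z.
have kx : 0 <= lambda^-1 by rewrite invr_ge0 ltW.
have kv : 0 <= rho^-1 * lambda^-1 by rewrite mulr_ge0// invr_ge0 ltW.
have [_ _ sol _] := xv_sol.
have x_ae : {ae @lebesgue_measure R, forall t, 0 <= t -> derivable x t 1}.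
  by apply: filterS sol => t solt /solt[].
have v_ae : {ae @lebesgue_measure R, forall t, 0 <= t -> derivable v t 1}.
  by apply: filterS sol => t solt /solt[].
split.
  split; first split.
  - exact: (derive1_in_L2 traj Phi_ge kx x_le_z x_ae).
  - exact: (derive1_in_L2 traj Phi_ge kv v_le_z v_ae).
  - exact: (F_x_in_L2 traj Phi_ge).
  split; last split.
  - exact: (derive1_dot_in_L1 traj Phi_ge kx kv x_le_z v_le_z x_ae v_ae).
  - exact: (derive1_cvg0 traj Phi_ge Phi_lt kx x_le_z).
  - exact: (derive1_cvg0 traj Phi_ge Phi_lt kv v_le_z).
  - exact: (F_x_cvg0 traj Phi_ge Phi_lt).
have [M xM] := x_bounded; have [xbar xbar_cluster] := bounded_cluster xM.
have [Phi_xbar F_xbar] := cluster_critical traj Phi_ge Phi_lt xbar_cluster.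
exists xbar; split; first by rewrite -[RHS]F_xbar -gradE.
have [|eta [g [r [eta_gt0 r_gt0 desg KLg]]]] := KL_grad (f := Phi) Phi_diff (KL xbar _).
  by exists (grad Phi xbar); exact: (grad_limiting_subdiff (f := Phi)).
have KLF p : enorm (p - xbar) < r -> Phi xbar < Phi p ->
    ((Phi p - Phi xbar)%:E < eta)%E ->
    1 <= derive1 (g : R -> R^o) (Phi p - Phi xbar) * enorm (F p).
  by rewrite -gradE; exact: KLg.
apply: cvg_enormP => e e0.
have [T T0 HT] := trajectory_cvg traj Phi_ge Phi_lt Phi_xbar eta_gt0 r_gt0 desg KLF
  xbar_cluster e0.
near=> t; apply: HT.
by near: t; apply: nbhs_pinfty_ge; exact: num_real.
Unshelve. all: by end_near. Qed.
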